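(* For any $1<p<2$ and $1\le q\le2$ there exists a constant $c_{p,q}>0$, depending only on $p$ and $q$, such that for any collection of mean zero independent functions $\{f_k\}_{k=1}^N$ from the Lorentz space $L_{p,q}$ on $[0,1]$, with $\|f_k\|_{L_{p,q}}\ge1$, $k=1,\dots,N$, and any $n<N$, we have $$d_n^{\mathrm{avg}}(\{f_1,\dots,f_N\},L_{p,q})_2\ge c_{p,q}(1-n/N)^{1/2}.$$
   Context: Functions are real-valued and Lebesgue measurable on $[0,1]$; independence is with respect to Lebesgue measure $m$; mean zero means $\int_0^1f_k(t)\,dt=0$. For $1<p<\infty$, $1\le q<\infty$, $L_{p,q}$ consists of all measurable $x$ on $[0,1]$ with $\|x\|_{p,q}:=\big(\int_0^1x^*(t)^q\,d(t^{q/p})\big)^{1/q}<\infty$, where $x^*(t):=\inf\{\tau\ge0:\ m\{s\in[0,1]:|x(s)|>\tau\}<t\}$, $0<t\le1$, is the non-increasing left-continuous rearrangement of $|x|$. For $q>p$ this functional is not subadditive, but it is equivalent to a rearrangement-invariant norm, and $L_{p,q}$ is considered as a Banach space with such a norm. Averaged width: $d_n^{\mathrm{avg}}(\{x_1,\ldots,x_N\},X)_2:=\inf_{\dim V\le n}\big(\frac1N\sum_{k=1}^N\rho(x_k,V)^2\big)^{1/2}$, where $\rho(x,V)=\inf_{v\in V}\|x-v\|_X$ and the infimum is over linear subspaces $V\subset X$ of dimension at most $n$. *)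

(* Defs.v *)
From HB Require Import structures.
From mathcomp Require Import all_boot all_order all_algebra.
From mathcomp Require Import all_classical all_reals all_analysis.
Set Implicit Arguments.
Unset Strict Implicit.
Unset Printing Implicit Defensive.
Import Order.TTheory GRing.Theory Num.Theory.
Import numFieldNormedType.Exports.
Local Open Scope classical_set_scope.
Local Open Scope ring_scope.

(* The real line with the sigma-algebra of Lebesgue-measurable sets: this is the
   domain type of completed_lebesgue_measure.  Functions on [0,1] are functions
   on this type of which only the values on [0,1] matter. *)
Notation lebR R := (caratheodory_type (wlength (@idfun R))^*%mu).

Section PowerCumulative.
Context {R : realType}.
Implicit Type r : R.

(* t |-> t ^ r for t >= 0, extended by its value at 0 to t < 0.  The absolute
   value only makes this a cumulative function for every real r; it is used
   with r = q / p > 0. *)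
Definition pow_cumul r (t : R) : R := (Num.max 0 t) `^ `|r|.

Let pow_cumul_nd r : {homo pow_cumul r : x y / x <= y}.
Proof.
move=> x y xy; apply: ge0_ler_powR => //.
- by rewrite nnegrE le_max lexx.
- by rewrite nnegrE le_max lexx.
- by rewrite ge_max !le_max lexx/= xy orbT.
Qed.

Let pow_cumul_rc r : right_continuous (pow_cumul r).
Proof.
move=> x; have [r0|r0] := eqVneq `|r| 0.
  rewrite /pow_cumul r0 powRr0; apply: cvg_near_cst.
  by apply: nearW => y; rewrite powRr0.
have {}r0 : 0 < `|r| by rewrite lt_neqAle eq_sym r0 normr_ge0.
have [x0|x0|<-] := ltgtP 0 x.
- rewrite /pow_cumul (max_r (ltW x0)) /(powR x) gt_eqF//.
  apply: cvg_within_filter.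
  apply: (@cvg_trans _ ((fun y => expR (`|r| * ln y)) @ x)).
    apply: near_eq_cvg; near=> y.
    have y0 : 0 < y by near: y; exact: lt_nbhsr.
    by rewrite max_r ?(ltW y0)// /powR gt_eqF.
  apply: (@continuous_comp _ _ _ (fun y => `|r| * ln y) (@expR R)).
    by apply: cvgMr; exact: continuous_ln.
  exact: continuous_expR.
- rewrite /pow_cumul (max_l (ltW x0)); apply: cvg_within_filter.
  apply: cvg_near_cst; near=> y.
  have y0 : y < 0 by near: y; exact: lt_nbhsl.
  by rewrite (max_l (ltW y0)).
- rewrite /pow_cumul maxxx powR0 ?gt_eqF//.
  apply: cvg_trans (powR_cvg0 r0); apply: near_eq_cvg; near=> y.
  by rewrite max_r.
Unshelve. all: by end_near. Qed.

HB.instance Definition _ r :=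
  isCumulative.Build R _ R (pow_cumul r) (@pow_cumul_nd r) (@pow_cumul_rc r).

End PowerCumulative.

Section Lorentz.
Context {R : realType}.
Implicit Types (x y v : lebR R -> R) (p q : R).

Local Notation m := (@completed_lebesgue_measure R).

Definition I01 : set (lebR R) := `[0%R, 1%R]%classic.

(* Only meaningful for 0 < t <= 1. *)
Definition rearrangement x (t : R) : R :=
  inf [set tau : R | 0 <= tau /\
    (m (I01 `&` [set s | (tau < `|x s|)%R]) < t%:E)%E].

Definition lorentz_functional p q x : \bar R :=
  ((\int[lebesgue_stieltjes_measure (pow_cumul (q / p))]_(t in `]0%R, 1%R])
      ((rearrangement x t) `^ q)%:E) `^ q^-1)%E.

Definition lorentz_space p q : set (lebR R -> R) :=
  [set x | measurable_fun I01 x /\ (lorentz_functional p q x < +oo)%E].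

Record is_equivalent_ri_norm p q (nrm : (lebR R -> R) -> R) : Prop := {
  ri_norm_triangle : forall x y,
    lorentz_space p q x -> lorentz_space p q y ->
    nrm (fun s => x s + y s) <= nrm x + nrm y ;
  ri_norm_scale : forall (a : R) x, lorentz_space p q x ->
    nrm (fun s => a * x s) = `|a| * nrm x ;
  ri_norm_rearrangement : forall x y,
    lorentz_space p q x -> lorentz_space p q y ->
    (forall t : R, 0 < t <= 1 -> rearrangement x t <= rearrangement y t) ->
    nrm x <= nrm y ;
  ri_norm_equivalent : exists A B : R, [/\ 0 < A, 0 < B &
    forall x, lorentz_space p q x ->
      A * fine (lorentz_functional p q x) <= nrm x
        <= B * fine (lorentz_functional p q x)] }.

(* The functionals with which L_{p,q} may be normed: the defining functional
   itself, or, when q > p (where that functional is not subadditive), any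
   equivalent rearrangement-invariant norm. *)
Definition is_lorentz_norm p q (nrm : (lebR R -> R) -> R) : Prop :=
  (forall x, lorentz_space p q x -> nrm x = fine (lorentz_functional p q x))
  \/ (p < q /\ is_equivalent_ri_norm p q nrm).

Definition mean_zero x : Prop := (\int[m]_(s in I01) (x s)%:E = 0)%E.

Definition independent_functions (N : nat) (f : 'I_N -> lebR R -> R) : Prop :=
  forall (J : {set 'I_N}) (B : 'I_N -> set R), (forall k, measurable (B k)) ->
    (m (I01 `&` [set s | forall k, k \in J -> B k (f k s)]) =
     \prod_(k in J) m (I01 `&` [set s | B k (f k s)]))%E.

Definition lin_span (n : nat) (v : 'I_n -> lebR R -> R) : set (lebR R -> R) :=
  [set (fun s => \sum_(i < n) a i * v i s) | a in [set: 'I_n -> R]].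

(* The v i need not be independent (nor distinct, nor nonzero), so these are
   the subspaces of X of dimension at most n. *)
Definition subspaces_dim_le (X : set (lebR R -> R)) (n : nat) :
    set (set (lebR R -> R)) :=
  [set V | exists2 v : 'I_n -> lebR R -> R, (forall i, X (v i)) & V = lin_span v].

Definition dist_to (nrm : (lebR R -> R) -> R) x (V : set (lebR R -> R)) : R :=
  inf [set nrm (fun s => x s - v s) | v in V].

Definition avg_width2 (X : set (lebR R -> R)) (nrm : (lebR R -> R) -> R)
    (n N : nat) (f : 'I_N -> lebR R -> R) : R :=
  inf [set Num.sqrt (N%:R^-1 * \sum_(k < N) dist_to nrm (f k) V ^+ 2) |
       V in subspaces_dim_le X n].

End Lorentz.

(* Main.v *)
(* The averaged width of the standard basis of the Euclidean space of dimension
   N is at least sqrt (1 - n/N), by the trace of a projector.  It is thus enough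
   to find g_1, ..., g_N biorthogonal to f_1, ..., f_N such that
   x |-> (\int x g_k)_k is bounded from L_{p,q} to l_2.

   In terms of a_i = 2^(-i/p) x^*(2^-i) the functional of L_{p,q} is the l_q
   norm of (a_i).  Let w_{k,j} be the sign of f_k truncated at the height
   f_k^*(2^-j) / 2, scaled to have L_1 norm of order 2^-j, and centred; then
   g_k is a combination of the w_{k,j} over j, with the coefficients of the
   functional norming the sequence of f_k.  Being a function of f_k, it is
   orthogonal to f_l for l <> k, because f_l is independent of it and has mean
   zero.

   For fixed j, a sum S = \sum_k c_k w_{k,j} with \sum_k c_k^2 <= 1 satisfies
   E (exp S + exp (- S) - 2) = O(2^-j), by independence.  Hence the integral
   of |S| over a set of measure 2^-i is O(2^(-(i + j) / 2)), and it is
   O(2^-i (1 + i - j)) if i >= j.  Since 2 < p' < oo, where 1/p + 1/p' = 1,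
   the resulting bound on (a_i) |-> (2^(j/p') \int |x| |S|)_j is a matrix with
   entries decaying geometrically in |i - j|, and the bound from L_{p,q} to l_2
   follows by a Schur test, where q <= 2 is used. *)
Require Import Defs.
From mathcomp Require Import all_boot all_order all_algebra.
From mathcomp Require Import all_classical all_reals all_analysis.
From mathcomp Require Import measurable_realfun ring lra.
Set Implicit Arguments.
Unset Strict Implicit.
Unset Printing Implicit Defensive.
Import Order.TTheory GRing.Theory Num.Theory.
Import numFieldNormedType.Exports.
Local Open Scope classical_set_scope.
Local Open Scope ring_scope.

(** * Orthogonal projection onto a row space *)

(** Since [p < 2], the functions [f_k] need not be square integrable and cannot serve as their own
    duals. Functions of [f_k] with finitely many values remain independent, and, being bounded, they
    pair with all of [L_{p,q}], which lies in [L_1]. Every bound has to be uniform in [N], so sums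
    over [k] may only be controlled by the [l_2] norm of their coefficients. Second moments alone
    would give the Cauchy-Schwarz bound [2^(-(i+j)/2)] for the integral of [|S|] over a set of
    measure [2^-i]. Against the weights [2^(i/p)] and [2^(j/p')] this becomes [2^((i-j)(1/p-1/2))],
    which decays for [i < j], as [p < 2], but grows for [i > j]. The exponential moment is there for
    the second range: it gives [(1+i-j) 2^(-(i-j)/p')], which decays because [p > 1]. The constant 2
    is subtracted from [exp S + exp (-S)] because the moment has to be small together with
    [2^-j]. *)

Lemma mulmx_tr_self (R : realFieldType) (n : nat) (w : 'rV[R]_n) :
  (w *m w^T) 0 0 = \sum_l w 0 l ^+ 2.
Proof. by rewrite mxE; apply: eq_bigr => l _; rewrite mxE expr2. Qed.

(** If the Gram matrix kills [v], then [v *m K] has squared length 0. *)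
Lemma gram_unitmx (R : realFieldType) (r n : nat) (K : 'M[R]_(r, n)) :
  row_free K -> K *m K^T \in unitmx.
Proof.
move=> Kfree; rewrite -row_free_unit; apply: inj_row_free => v vG.
have /(congr1 (fun A : 'M[R]_1 => A 0 0)) : (v *m K) *m (v *m K)^T = 0.
  by rewrite trmx_mul mulmxA -(mulmxA v) vG mul0mx.
rewrite mulmx_tr_self mxE => /psumr_eq0P vK0.
have vK : v *m K = 0.
  apply/matrixP => i l; rewrite ord1 !mxE.
  have /eqP := vK0 (fun l _ => sqr_ge0 _) l isT.
  by rewrite sqrf_eq0 mxE => /eqP.
by apply: (row_free_inj Kfree); rewrite vK mul0mx.
Qed.

(* [d] is the diagonal of the orthogonal projector onto the orthogonal
   complement of the row space of [B], whose trace is at least [N - n]. *)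
Lemma sum_dist_rowspace (R : realFieldType) (N n : nat) (B : 'M[R]_(n, N)) :
  exists d : 'I_N -> R, N%:R - n%:R <= \sum_k d k /\
    forall k (w : 'rV[R]_N), (delta_mx 0 k - w <= B)%MS ->
      d k <= \sum_l w 0 l ^+ 2.
Proof.
(* The rows of [K] form a basis of the orthogonal complement of the row space of [B]; [P] below is
   the orthogonal projector onto their span, by the Gram formula. *)
have [r [K [Kfree KB leNr]]] : exists r (K : 'M[R]_(r, N)),
    [/\ row_free K, K *m B^T = 0 & N%:R - n%:R <= r%:R :> R].
  exists (\rank (kermx B^T)), (row_base (kermx B^T)); split.
  exact: row_base_free.
  by apply/sub_kermxP; rewrite eq_row_base.
  rewrite lerBlDr -natrD ler_nat mxrank_ker addnC -leq_subLR leq_sub2l //.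
  exact: rank_leq_col.
have BK : B *m K^T = 0 by apply: trmx_inj; rewrite trmx_mul trmxK KB trmx0.
have Gu := gram_unitmx Kfree; set G := K *m K^T in Gu.
have Gsym : G^T = G by rewrite trmx_mul trmxK.
pose P := K^T *m invmx G *m K.
have Psym : P^T = P by rewrite !trmx_mul trmxK trmx_inv Gsym mulmxA.
have PP : P *m P = P.
  rewrite /P -!mulmxA; congr (_ *m (_ *m _)).
  by rewrite (mulmxA K) -/G mulKVmx.
have BP : B *m P = 0 by rewrite !mulmxA BK !mul0mx.
have trP : \tr P = r%:R by rewrite mxtrace_mulC mulmxA -/G mulmxV // mxtrace1.
clearbody P; exists (fun k => P k k); split; first by rewrite -/(\tr P) trP.
move=> k w /submxP[a ea].
have wP : w *m P = delta_mx 0 k *m P.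
  by apply/eqP; rewrite eq_sym -subr_eq0 -mulmxBl ea -mulmxA BP mulmx0.
have Pw : P *m w^T = P *m (delta_mx 0 k)^T.
  by rewrite -[P in LHS]Psym -trmx_mul wP trmx_mul Psym.
rewrite -mulmx_tr_self.
(* Pythagoras: [w *m P] is orthogonal to the rest of [w], and it is row [k] of [P], of squared
   length [P k k] since [P] is a symmetric idempotent. *)
have -> : w *m w^T = w *m P *m w^T + (w *m (1%:M - P)) *m (w *m (1%:M - P))^T.
  have QT : (1%:M - P)^T = 1%:M - P by rewrite [LHS]linearB /= tr_scalar_mx Psym.
  have QQ : (1%:M - P) *m (1%:M - P) = 1%:M - P.
    by rewrite mulmxBl mul1mx mulmxBr mulmx1 PP subrr subr0.
  rewrite [(w *m (1%:M - P))^T]trmx_mul QT mulmxA -(mulmxA w (_ - _)) QQ.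
  by rewrite mulmxBr mulmx1 mulmxBl addrC subrK.
rewrite mxE mulmx_tr_self wP -mulmxA Pw trmx_delta mulmxA -rowE -colE !mxE.
by rewrite lerDl; apply: sumr_ge0 => l _; exact: sqr_ge0.
Qed.

(** * Real inequalities and nonnegative series *)

Lemma nneseries_shift_le (R : realType) (A : nat -> \bar R) :
  (forall i, 0 <= A i)%E -> (\sum_(i <oo) A i.+1 <= \sum_(i <oo) A i)%E.
Proof.
move=> A0; rewrite [leRHS]nneseries_recl // -(nneseries_addn 1 A0).
under [in leRHS]eq_eseriesr do rewrite addn1.
by rewrite leeDr.
Qed.

(** Subtraction of naturals truncates, so the exponent is the distance from [i] to [j]; each side of
    [j] contributes at most [1 / (1 - r)]. This bounds both the row and the column sums in the Schur
    test. *)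
Lemma geometric_dist_sum_le (R : realFieldType) (r : R) n j : 0 <= r < 1 ->
  \sum_(i < n) r ^+ ((i - j) + (j - i)) <= 2 / (1 - r).
Proof.
move=> /andP[r0 r1]; pose c := (1 - r)^-1.
have c1 : c * (1 - r) = 1 by rewrite mulVf // subr_eq0 gt_eqF.
have c0 : 0 < c by rewrite invr_gt0 subr_gt0.
have rn m : 0 <= r ^+ m by rewrite exprn_ge0.
have h1 : forall n, (n <= j)%N ->
    \sum_(i < n) r ^+ ((i - j) + (j - i)) <= c * r ^+ (j - n).
  elim=> [|m IHm] mj; first by rewrite big_ord0 mulr_ge0 // ltW.
  rewrite big_ord_recr /=; apply: le_trans (lerD (IHm (ltnW mj)) (lexx _)) _.
  rewrite (eqP (ltnW mj : (m - j)%N == 0%N)) add0n.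
  have -> : (j - m)%N = (j - m.+1).+1 by rewrite subnS prednK // subn_gt0.
  have := rn (j - m.+1)%N; rewrite exprS; move: (r ^+ _) => y y0.
  have h : (c * r + r) <= c by nra.
  have -> : c * (r * y) + r * y = (c * r + r) * y by ring.
  by rewrite ler_wpM2r.
have h2 m : \sum_(i < j + m) r ^+ ((i - j) + (j - i)) <= c + c * (1 - r ^+ m).
  elim: m => [|m IHm].
    by rewrite addn0 expr0 subrr mulr0 addr0 (le_trans (h1 j (leqnn j))) // subnn mulr1.
  rewrite addnS big_ord_recr /=; apply: le_trans (lerD IHm (lexx _)) _.
  rewrite addKn (eqP (leq_addr m j : (j - (j + m))%N == 0%N)) addn0 exprS.
  move: (r ^+ m) => y.
  have -> : c * (1 - r * y) = c * (1 - y) + c * (1 - r) * y by ring.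
  by rewrite c1; lra.
rewrite mulrDl -/c !mul1r.
have [nj|jn] := leqP n j.
  apply: le_trans (h1 n nj) _; have : r ^+ (j - n) <= 1 by rewrite exprn_ile1 // ltW.
  nra.
rewrite -(subnKC (ltnW jn)); apply: le_trans (h2 _) _.
by have := rn (n - j)%N; nra.
Qed.

Lemma nneseries_le_partial (R : realType) (u : nat -> R) (B : R) :
  (forall i, 0 <= u i) -> (forall n, \sum_(i < n) u i <= B) ->
  (\sum_(i <oo) (u i)%:E <= B%:E)%E.
Proof.
move=> u0 uB; apply: lime_le.
  by apply: is_cvg_nneseries => i _ _; rewrite lee_fin.
by apply: nearW => n; rewrite sumEFin lee_fin big_mkord.
Qed.

Lemma partial_sum_le_nneseries (R : realType) (u : nat -> R) n :
  (forall i, 0 <= u i) -> ((\sum_(i < n) u i)%:E <= \sum_(i <oo) (u i)%:E)%E.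
Proof.
move=> u0; rewrite -sumEFin -(big_mkord xpredT (fun i => (u i)%:E)).
by apply: nneseries_lim_ge => i _ _; rewrite lee_fin.
Qed.

Section PowerInequalities.
Context {R : realType}.
Variables (q : R).
Hypotheses (q12 : 1 <= q <= 2).

(** This is where [q <= 2] enters: if [a < b], then [a b^(q-1) <= a^(q-1) b], because
    [(a/b)^(2-q) <= 1]. If [b <= a], then [a b^(q-1) <= a^q] because [q >= 1]. *)
Lemma sqr_mul_powRB1_le (a b : R) : 0 <= a -> 0 <= b ->
  (a * b `^ (q - 1)) ^+ 2 <= (a `^ q) ^+ 2 + a `^ q * b `^ q.
Proof.
move=> a0 b0; case/andP: q12 => q1 q2; have q0 : 0 < q by lra.
have aq := mulr_powRB1 a0 q0; have bq := mulr_powRB1 b0 q0.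
have [ba|ab] := leP b a.
  apply: (@le_trans _ _ ((a `^ q) ^+ 2)); last by rewrite lerDl mulr_ge0 ?powR_ge0.
  rewrite lerXn2r ?nnegrE ?mulr_ge0 ?powR_ge0 // -aq ler_wpM2l //.
  by apply: ge0_ler_powR; rewrite ?nnegrE // subr_ge0.
apply: (@le_trans _ _ (a `^ q * b `^ q)); last by rewrite lerDr sqr_ge0.
have [->|a_neq0] := eqVneq a 0; first by rewrite mul0r expr0n /= mulr_ge0 ?powR_ge0.
have {a_neq0 a0} a0 : 0 < a by rewrite lt_neqAle eq_sym a_neq0.
have {}b0 : 0 < b := lt_trans a0 ab.
have e (y : R) : 0 < y -> y = y `^ (q - 1) * y `^ (2 - q).
  move=> y0; rewrite -powRD; last by rewrite (gt_eqF y0) implybT.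
  by rewrite (_ : q - 1 + (2 - q) = 1) ?powRr1 ?(ltW y0) //; lra.
have key : a * b `^ (q - 1) <= a `^ (q - 1) * b.
  rewrite {1}(e a a0) {2}(e b b0) -mulrA ler_wpM2l ?powR_ge0 // mulrC.
  rewrite ler_wpM2l ?powR_ge0 //.
  by apply: ge0_ler_powR; rewrite ?nnegrE ?subr_ge0 // ltW.
rewrite -aq -bq expr2.
have -> : a * a `^ (q - 1) * (b * b `^ (q - 1)) =
    a * b `^ (q - 1) * (a `^ (q - 1) * b) by ring.
by rewrite ler_wpM2l // mulr_ge0 ?powR_ge0 // ltW.
Qed.

(** Separates the variables for the Schur test: [a] will be a coefficient of [x] at level [i] and
    [b k] a normalized coefficient of [f_k] at level [j], so the right side is a term in [i] alone
    plus a term in [j] alone. *)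
Lemma mul_sqrt_sum_le (I : finType) (c b : I -> R) (a : R) :
  0 <= a -> (forall k, 0 <= b k) -> \sum_k c k ^+ 2 <= 1 ->
  a * Num.sqrt (\sum_k (c k * b k `^ (q - 1)) ^+ 2) <=
    a `^ q + \sum_k c k ^+ 2 * b k `^ q.
Proof.
move=> a0 b0 c1; set S := \sum_k _ * _.
have S0 : 0 <= S by apply: sumr_ge0 => k _; rewrite mulr_ge0 ?sqr_ge0 ?powR_ge0.
have aq0 := powR_ge0 a q.
rewrite -[leLHS]ger0_norm ?mulr_ge0 ?sqrtr_ge0 // -[leRHS]ger0_norm ?addr_ge0 //.
rewrite -ler_sqr ?nnegrE // !real_normK ?num_real // exprMn sqr_sqrtr; last first.
  by apply: sumr_ge0 => k _; exact: sqr_ge0.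
rewrite mulr_sumr.
apply: (@le_trans _ _ (\sum_k c k ^+ 2 * ((a `^ q) ^+ 2 + a `^ q * b k `^ q))).
  apply: ler_sum => k _; rewrite exprMn mulrCA -exprMn ler_wpM2l ?sqr_ge0 //.
  exact: sqr_mul_powRB1_le.
have -> : \sum_k c k ^+ 2 * ((a `^ q) ^+ 2 + a `^ q * b k `^ q) =
    (\sum_k c k ^+ 2) * (a `^ q) ^+ 2 + a `^ q * S.
  by rewrite /S mulr_suml mulr_sumr -big_split /=; apply: eq_bigr => k _; ring.
have : (\sum_k c k ^+ 2) * (a `^ q) ^+ 2 <= (a `^ q) ^+ 2 by rewrite ler_piMl ?sqr_ge0.
move: aq0 S0; nra.
Qed.
End PowerInequalities.

(** * Elementary inequalities for exponentials and the hyperbolic cosine *)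

Lemma expR_le_quadratic (R : realType) (t : R) :
  `|t| <= 1 / 2 -> expR t <= 1 + t + 2 * t ^+ 2.
Proof.
rewrite ler_norml => /andP[t1 t2]; rewrite -[t in expR t]opprK expRN.
have := expR_ge1Dx (- t) => h; have h0 : 0 < 1 - t by lra.
apply: (@le_trans _ _ (1 - t)^-1); first by rewrite lef_pV2 ?posrE ?expR_gt0.
rewrite -[leLHS]mul1r ler_pdivrMr //.
have -> : (1 + t + 2 * t ^+ 2) * (1 - t) = 1 + t ^+ 2 * (1 - 2 * t) by ring.
by rewrite lerDl mulr_ge0 ?sqr_ge0 //; lra.
Qed.

Lemma expR_half_sub_ge (R : realType) (t : R) :
  0 <= t -> t / 2 <= expR (t / 2) - expR (- (t / 2)).
Proof.
move=> t0; have := expR_ge1Dx (t / 2).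
have : expR (- (t / 2)) <= 1 by rewrite expR_le1; lra.
lra.
Qed.

(** Both sides are [4 sinh^2 (t/2)]; in this form the excess is visibly nonnegative, and
    [expR_half_sub_ge] makes it at least [t^2 / 4]. *)
Lemma cosh_excessE (R : realType) (t : R) :
  expR t + expR (- t) - 2 = (expR (t / 2) - expR (- (t / 2))) ^+ 2.
Proof.
have h (u : R) : expR u = expR (u / 2) ^+ 2.
  by rewrite expr2 -expRD -splitr.
rewrite [in LHS]h [expR (- t) in LHS]h mulNr.
by have := expRxMexpNx_1 (t / 2); nra.
Qed.

Lemma cosh_excess_abs (R : realType) (t : R) :
  expR t + expR (- t) - 2 = expR `|t| + expR (- `|t|) - 2.
Proof. by case: (ger0P t) => // _; rewrite opprK (addrC (expR t)). Qed.

(** The inequality between arithmetic and geometric means, with [lam] left free to be optimized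
    after integration. *)
Lemma abs_le_cosh_excess (R : realType) (lam t : R) : 0 < lam ->
  `|t| <= lam + lam^-1 * (expR t + expR (- t) - 2).
Proof.
move=> l0; rewrite cosh_excess_abs cosh_excessE.
have := expR_half_sub_ge (normr_ge0 t); set e := (X in _ <= X) => he.
have e0 : 0 <= e by apply: le_trans he; rewrite divr_ge0.
rewrite -(ler_pM2l l0) mulrDr mulrA divff ?gt_eqF // mul1r.
rewrite -/e; have : lam * `|t| <= lam * (2 * e) by rewrite ler_pM2l //; lra.
have := sqr_ge0 (lam - e); rewrite sqrrB; lra.
Qed.

(** Beyond the threshold [2 (1 + L)], half of the exponential growth of the excess pays for the
    factor [exp (-L)] and the other half still dominates [|t|]. *)
Lemma abs_le_log_cosh_excess (R : realType) (L t : R) : 0 <= L ->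
  `|t| <= 2 * (1 + L) + 8 * expR (- L) * (expR t + expR (- t) - 2).
Proof.
move=> L0; have [tL|tL] := leP `|t| (2 * (1 + L)).
  by rewrite (le_trans tL) // lerDl cosh_excessE mulr_ge0 ?sqr_ge0.
rewrite cosh_excess_abs; set u := `|t| in tL *.
have eL : expR (- (u / 2)) <= expR (- L) by rewrite ler_expR; lra.
have e1 : 1 + u / 2 + (u / 4) ^+ 2 <= expR (u / 2).
  have -> : expR (u / 2) = expR (u / 4) ^+ 2 by rewrite expr2 -expRD; congr expR; lra.
  have := expR_ge1Dx (u / 4); nra.
have e2 : expR u * expR (- (u / 2)) = expR (u / 2) by rewrite -expRD; congr expR; lra.
have e5 : expR (- (u / 2)) <= 1 by rewrite expR_le1; lra.
have e6 : 1 + u <= expR u := expR_ge1Dx u.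
have e7 : 0 <= expR (- (u / 2)) * expR (- u) by rewrite mulr_ge0 ?expR_ge0.
have : expR (- (u / 2)) * (expR u + expR (- u) - 2) <=
    expR (- L) * (expR u + expR (- u) - 2).
  by rewrite ler_wpM2r //; have := expR_ge0 (- u); lra.
have : u / 8 <= expR (- (u / 2)) * (expR u + expR (- u) - 2).
  rewrite !mulrDr [_ * expR u]mulrC e2; nra.
lra.
Qed.

(** With all powers of [2^-1] written as exponentials, comparing products of them becomes linear
    arithmetic in the exponents. *)
Lemma half_expnE (R : realType) i : 2^-1 ^+ i = expR (- (i%:R * ln 2)) :> R.
Proof. by rewrite expRN expRM_natl lnK ?posrE // exprVn. Qed.

Lemma half_powRE (R : realType) i (r : R) :
  (2^-1 ^+ i) `^ r = expR (- (i%:R * r * ln 2)).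
Proof. by rewrite half_expnE -expRM; congr expR; ring. Qed.

Lemma powR_invl (R : realType) (a r : R) : 0 <= a -> a^-1 `^ r = (a `^ r)^-1.
Proof. by move=> a0; rewrite -powR_inv1 // powRAC powR_inv1 // powR_ge0. Qed.

Lemma half_powR_lt1 (R : realType) (r : R) : 0 < r -> 2^-1 `^ r < 1 :> R.
Proof.
move=> r0; have : 2^-1 `^ r < 1 `^ r.
  by apply: gt0_ltr_powR; rewrite ?nnegrE // invf_lt1 ?ltr1n.
by rewrite powR1.
Qed.

Lemma powRD_le (R : realType) (q u v : R) : 0 <= q -> 0 <= u -> 0 <= v ->
  (u + v) `^ q <= 2 `^ q * (u `^ q + v `^ q).
Proof.
move=> q0 u0 v0; rewrite mulrDr -!powRM //.
wlog uv : u v u0 v0 / u <= v.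
  move=> h; have [/h|/ltW/h] := leP u v; first exact.
  by move=> {}h; rewrite (addrC u) (addrC ((2 * u) `^ q)); exact: h.
apply: (@le_trans _ _ ((2 * v) `^ q)); last by rewrite lerDr powR_ge0.
by apply: ge0_ler_powR; rewrite ?nnegrE ?addr_ge0 ?mulr_ge0 //; lra.
Qed.

(** The bound is asserted for every [n >= M], so that the cut-offs of finitely many series can be
    merged by taking their maximum. *)
Lemma exists_partial_sum_half (R : realType) (u : nat -> R) (S : R) :
  (forall i, 0 <= u i) -> (\sum_(i <oo) (u i)%:E = S%:E)%E -> 0 < S ->
  exists M, forall n, (M <= n)%N -> S / 2 <= \sum_(j < n) u j.
Proof.
move=> u0 uS S0; apply: contrapT => h.
have : (\sum_(i <oo) (u i)%:E <= (S / 2)%:E)%E.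
  apply: nneseries_le_partial => // n; rewrite leNgt; apply/negP => /ltW Sn.
  apply: h; exists n => m nm; apply: le_trans Sn _.
  rewrite -!(big_mkord xpredT u) (big_cat_nat (leq0n n) nm) /= lerDl.
  by apply: sumr_ge0.
rewrite uS lee_fin; lra.
Qed.

(** * Weighted sums of independent functions *)

Section ProbabilityMeasure.
Context d (T : measurableType d) (R : realType).
Variables (mu : {measure set T -> \bar R}) (D : set T).
Hypotheses (mD : measurable D) (muD : mu D = 1%E).

Lemma mu_sub_fin_num (A : set T) : measurable A -> A `<=` D -> mu A \is a fin_num.
Proof.
move=> mA AD; rewrite ge0_fin_numE //; apply: (@le_lt_trans _ _ (mu D)).
  by apply: le_measure; rewrite ?inE.
by rewrite muD ltry.
Qed.

Lemma bounded_integrable (A : set T) (f : T -> R) (M : R) :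
  measurable A -> A `<=` D -> measurable_fun A f ->
  (forall s, A s -> `|f s| <= M) -> mu.-integrable A (EFin \o f).
Proof.
move=> mA AD mf fM; apply: measurable_bounded_integrable => //.
  by rewrite -ge0_fin_numE // mu_sub_fin_num.
exists M; split; first exact: num_real.
by move=> x Mx s As; exact: le_trans (fM s As) (ltW Mx).
Qed.

Lemma Rintegral_sum (I : Type) (r : seq I) (f : I -> T -> R) :
  (forall i, mu.-integrable D (EFin \o f i)) ->
  \int[mu]_(s in D) (\sum_(i <- r) f i s) = \sum_(i <- r) \int[mu]_(s in D) f i s.
Proof.
move=> fi; elim: r => [|i r IHr].
  rewrite big_nil; under eq_Rintegral do rewrite big_nil.
  by rewrite Rintegral_cst // mul0r.
rewrite big_cons -IHr -RintegralD //.
  by apply: eq_Rintegral => s _; rewrite big_cons.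
have := @integrable_sum _ _ _ mu D mD I r xpredT (fun i => EFin \o f i) (fun i _ => fi i).
by apply: eq_integrable => // s _; rewrite /= sumEFin.
Qed.

(* For Lebesgue measure on [0,1] this is convertible to
   [independent_functions]. *)
Definition mutually_independent N (f : 'I_N -> T -> R) : Prop :=
  forall (J : {set 'I_N}) (B : 'I_N -> set R), (forall k, measurable (B k)) ->
    (mu (D `&` [set s | forall k, k \in J -> B k (f k s)]) =
     \prod_(k in J) mu (D `&` [set s | B k (f k s)]))%E.

Lemma finite_valued_indicE (I : finType) (kap : R -> I) (a : I -> R) y :
  a (kap y) = \sum_v a v * \1_(kap @^-1` [set v]) y.
Proof.
rewrite (bigD1 (kap y)) //= indicE mem_set // mulr1 big1 ?addr0 // => v vy.
by rewrite indicE memNset ?mulr0 //= => e; rewrite e eqxx in vy.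
Qed.

Lemma Rintegral_indic_setI (B : set T) : measurable (D `&` B) ->
  \int[mu]_(s in D) \1_B s = fine (mu (D `&` B)).
Proof.
move=> mDB; rewrite /Rintegral.
transitivity (fine (\int[mu]_(s in D) (\1_(D `&` B) s)%:E)).
  congr fine; apply: eq_integral => s /set_mem Ds; congr EFin.
  by rewrite !indicE in_setI (mem_set Ds).
by rewrite integral_indic // setIAC setIid.
Qed.

(* A finite-valued Borel function of [f k] is written [a k \o kap k \o f k]
   with [kap k] a measurable classification of the line into finitely many
   classes; composing it with any function keeps this form. *)
Lemma Rintegral_prod_independent N (I : finType) (f : 'I_N -> T -> R)
    (kap : 'I_N -> R -> I) (a : 'I_N -> I -> R) :
  (forall k, measurable_fun D (f k)) -> mutually_independent f ->
  (forall k v, measurable (kap k @^-1` [set v])) ->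
  \int[mu]_(s in D) (\prod_k a k (kap k (f k s))) =
    \prod_k \int[mu]_(s in D) (a k (kap k (f k s))).
Proof.
move=> mf indf mkap.
have fiB (B : set T) (c : R) : measurable (D `&` B) ->
    mu.-integrable D (EFin \o (fun s => c * \1_B s)).
  move=> mB; apply: (@bounded_integrable _ _ `|c|) => //.
    apply: (@eq_measurable_fun _ _ _ _ D (fun s => c * \1_(D `&` B) s)).
      by move=> s sD; rewrite !indicE in_setI sD.
    by apply: measurable_funM => //; exact: measurable_indic.
  by move=> s _; rewrite normrM indicE; case: (s \in B); rewrite ?normr1 ?normr0 ?mulr1 ?mulr0.
pose B k v := [set s | (kap k @^-1` [set v]) (f k s)].
have mB k v : measurable (D `&` B k v) by exact: mf.
have E1 k : \int[mu]_(s in D) (a k (kap k (f k s))) =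
    \sum_v a k v * fine (mu (D `&` B k v)).
  under eq_Rintegral do rewrite finite_valued_indicE.
  rewrite Rintegral_sum; last by move=> v; exact: (fiB (B k v)).
  apply: eq_bigr => v _; rewrite RintegralZl //; last first.
    have := fiB (B k v) 1 (mB k v); apply: eq_integrable => // s _.
    by rewrite /= mul1r.
  by rewrite -Rintegral_indic_setI.
transitivity (\prod_k \sum_v a k v * fine (mu (D `&` B k v))); last first.
  by apply: eq_bigr => k _; rewrite E1.
(* The product of sums is expanded over all assignments [g] of a class to each index; independence
   factors the measure of each joint event [BB g]. *)
rewrite bigA_distr_bigA /=.
pose BB (g : {ffun 'I_N -> I}) := [set s | forall k, k \in [set: 'I_N]%SET -> B k (g k) s].
have mBB g : measurable (D `&` BB g).
  have -> : D `&` BB g = D `&` \bigcap_(k in [set: 'I_N]) (D `&` B k (g k)).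
    rewrite predeqE => s; split=> [[Ds Bs]|[Ds Bs]]; split => //.
      by move=> k _; split => //; apply: Bs; rewrite inE.
    by move=> k _; have [] := Bs k Logic.I.
  by apply: measurableI => //; apply: fin_bigcap_measurable => // k _; exact: mB.
transitivity (\int[mu]_(s in D) \sum_(g : {ffun 'I_N -> I})
  ((\prod_k a k (g k)) * \1_(BB g) s)).
  apply: eq_Rintegral => s _.
  under eq_bigr do rewrite finite_valued_indicE.
  rewrite bigA_distr_bigA /=; apply: eq_bigr => g _; rewrite big_split /=.
  congr (_ * _); rewrite indicE.
  have [sB|sB] := boolP (s \in BB g).
    rewrite big1 // => k _; rewrite indicE mem_set //.
    by move/set_mem : sB => /(_ k); rewrite inE; exact.
  apply/eqP; apply/prodf_eq0.
  have [k nk] : exists k, ~ B k (g k) s.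
    by apply/not_existsP => h; move/negP: sB; apply; apply/mem_set => k _; exact: contrapT (h k).
  by exists k => //; rewrite indicE memNset.
rewrite Rintegral_sum; last by move=> g; exact: fiB.
apply: eq_bigr => g _; rewrite big_split /=.
have := indf [set: 'I_N]%SET (fun k => kap k @^-1` [set g k]) (fun k => mkap _ _).
rewrite RintegralZl //; last first.
  have := fiB (BB g) 1 (mBB g); apply: eq_integrable => // s _.
  by rewrite /= mul1r.
move=> indg; congr (_ * _).
rewrite (Rintegral_indic_setI (mBB g)) indg.
under [RHS]eq_bigr => k _ do rewrite -[fine _]/(fine (mu (D `&` B k (g k)))).
apply: EFin_inj; rewrite -prodEFin fineK; last first.
  by rewrite -indg; apply: (mu_sub_fin_num (mBB g)) => s [].
apply: eq_big => [k|k _]; first by rewrite inE.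
by rewrite fineK //; apply: (mu_sub_fin_num (mB _ _)) => s [].
Qed.

Lemma finite_valued_measurable (I : finType) (f : T -> R) (kap : R -> I) (a : I -> R) :
  measurable_fun D f -> (forall v, measurable (kap @^-1` [set v])) ->
  measurable_fun D (fun s => a (kap (f s))).
Proof.
move=> mf mkap; under eq_fun do rewrite finite_valued_indicE.
apply: measurable_sum => v; apply: measurable_funM => //.
by apply: measurableT_comp => //; exact: measurable_indic.
Qed.

Lemma finite_valued_integrable (I : finType) (f : T -> R) (kap : R -> I) (a : I -> R) :
  measurable_fun D f -> (forall v, measurable (kap @^-1` [set v])) ->
  mu.-integrable D (EFin \o (fun s => a (kap (f s)))).
Proof.
move=> mf mkap.
apply: (@bounded_integrable D _ (\sum_v `|a v|)) => //.
  exact: (finite_valued_measurable a mf mkap).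
move=> s _; rewrite (bigD1 (kap (f s))) //= lerDl.
by apply: sumr_ge0.
Qed.

(** * The exponential moment of a weighted sum *)

Section ExponentialMoment.
Variables (N : nat) (I : finType) (f : 'I_N -> T -> R).
Variables (kap : 'I_N -> R -> I) (a : 'I_N -> I -> R) (c : 'I_N -> R) (del : R).
Hypotheses (mf : forall k, measurable_fun D (f k)) (indf : mutually_independent f).
Hypothesis mkap : forall k v, measurable (kap k @^-1` [set v]).
Hypothesis del0 : 0 <= del.
Hypothesis a_le : forall k v, `|a k v| <= 1 / 2.
Hypothesis a_mean : forall k, \int[mu]_(s in D) a k (kap k (f k s)) = 0.
Hypothesis a_var : forall k, \int[mu]_(s in D) (a k (kap k (f k s))) ^+ 2 <= del.
Hypothesis c_le : \sum_k c k ^+ 2 <= 1.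

(** Independence factors the integral. In each factor the linear term has mean zero, which leaves
    [1 + 2 del c_k^2 <= exp (2 del c_k^2)]; since the [c_k^2] sum to at most 1, the bound does not
    depend on [N]. *)
Lemma exp_moment_le :
  \int[mu]_(s in D) expR (\sum_k c k * a k (kap k (f k s))) <= expR (2 * del).
Proof.
have fvi k (g : I -> R) : mu.-integrable D (EFin \o (fun s => g (kap k (f k s)))).
  exact: (finite_valued_integrable g (mf k) (mkap k)).
under eq_Rintegral do rewrite expR_sum.
rewrite (@Rintegral_prod_independent _ _ _ _ (fun k v => expR (c k * a k v))) //.
have ck1 k : c k ^+ 2 <= 1.
  apply: le_trans c_le; rewrite (bigD1 k) //= lerDl.
  by apply: sumr_ge0 => i _; exact: sqr_ge0.
apply: (@le_trans _ _ (\prod_k expR (2 * del * c k ^+ 2))); last first.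
  rewrite -expR_sum ler_expR -mulr_sumr ler_piMr //.
  by rewrite mulr_ge0.
apply: ler_prod => k _; rewrite Rintegral_ge0 /=; last by move=> s _; exact: expR_ge0.
apply: (@le_trans _ _ (1 + 2 * del * c k ^+ 2)); last exact: expR_ge1Dx.
have ick := ck1 k; have ack v : `|c k * a k v| <= 1 / 2.
  rewrite normrM -[leRHS]mul1r ler_pM // -(expr_le1 (n := 2)) // -normrX.
  by rewrite ger0_norm ?sqr_ge0.
have ia : mu.-integrable D (EFin \o (fun s => a k (kap k (f k s)))) := fvi k (a k).
have ia2 : mu.-integrable D (EFin \o (fun s => (a k (kap k (f k s))) ^+ 2)) :=
  fvi k (fun v => a k v ^+ 2).
apply: (@le_trans _ _ (\int[mu]_(s in D)
    (1 + c k * a k (kap k (f k s)) + 2 * c k ^+ 2 * (a k (kap k (f k s))) ^+ 2))).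
  apply: le_Rintegral => //.
  exact: (fvi k (fun v => expR (c k * a k v))).
  exact: (fvi k (fun v => 1 + c k * a k v + 2 * c k ^+ 2 * a k v ^+ 2)).
  by move=> s _; rewrite (le_trans (expR_le_quadratic (ack _))) // exprMn mulrA.
rewrite RintegralD //; last 2 first.
  exact: (fvi k (fun v => 1 + c k * a k v)).
  exact: (fvi k (fun v => 2 * c k ^+ 2 * a k v ^+ 2)).
rewrite RintegralD //; last 2 first.
  exact: (fvi k (fun v => 1)).
  exact: (fvi k (fun v => c k * a k v)).
rewrite Rintegral_cst // !RintegralZl // a_mean mulr0 addr0 muD mulr1 lerD2l.
have := a_var k; have := sqr_ge0 (c k); nra.
Qed.

End ExponentialMoment.

Section WeightedSum.
Variables (N : nat) (I : finType) (f : 'I_N -> T -> R).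
Variables (kap : 'I_N -> R -> I) (a : 'I_N -> I -> R) (c : 'I_N -> R) (del : R).
Hypotheses (mf : forall k, measurable_fun D (f k)) (indf : mutually_independent f).
Hypothesis mkap : forall k v, measurable (kap k @^-1` [set v]).
Hypothesis del01 : 0 <= del <= 1.
Hypothesis a_le : forall k v, `|a k v| <= 1 / 2.
Hypothesis a_mean : forall k, \int[mu]_(s in D) a k (kap k (f k s)) = 0.
Hypothesis a_var : forall k, \int[mu]_(s in D) (a k (kap k (f k s))) ^+ 2 <= del / 4.
Hypothesis c_le : \sum_k c k ^+ 2 <= 1.

Let S s := \sum_k c k * a k (kap k (f k s)).
Let Z s := expR (S s) + expR (- S s) - 2.

Let mS : measurable_fun D S.
Proof.
apply: measurable_sum => k; apply: measurable_funM => //.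
exact: (finite_valued_measurable (a k) (mf k) (mkap k)).
Qed.

Let bS s : `|S s| <= \sum_k `|c k|.
Proof.
apply: le_trans (ler_norm_sum _ _ _) _; apply: ler_sum => k _.
by rewrite normrM ler_piMr //; have := a_le k (kap k (f k s)); lra.
Qed.

Let iexp (b : R) : mu.-integrable D (EFin \o (fun s => expR (b * S s))).
Proof.
apply: (@bounded_integrable D _ (expR (`|b| * \sum_k `|c k|))) => //.
  by apply: measurableT_comp => //; apply: measurable_funM.
move=> s _; rewrite ger0_norm ?expR_ge0 // ler_expR.
rewrite (le_trans (ler_norm _)) // normrM ler_wpM2l //.
Qed.

Let Z_ge0 s : 0 <= Z s.
Proof. by rewrite /Z cosh_excessE sqr_ge0. Qed.

Let mZ : measurable_fun D Z.
Proof.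
apply: measurable_funB => //; apply: measurable_funD => //; apply: measurableT_comp => //.
exact: measurable_funN.
Qed.

Lemma integral_cosh_excess_le : (\int[mu]_(s in D) (Z s)%:E <= (2 * del)%:E)%E.
Proof.
have i1 := iexp 1; have i2 := iexp (-1).
have ic : mu.-integrable D (EFin \o (fun=> 2 : R)).
  by apply: (@bounded_integrable D _ 2) => // s _; rewrite ger0_norm.
have i12 : mu.-integrable D (EFin \o (fun s => expR (1 * S s) + expR (-1 * S s))).
  exact: (integrableD mD i1 i2).
have ZE : Z = fun s => expR (1 * S s) + expR (-1 * S s) - 2.
  by apply/funext => s; rewrite mul1r mulN1r.
have iZ : mu.-integrable D (EFin \o Z).
  by rewrite ZE; exact: (integrableB mD i12 ic).
rewrite -[leLHS]fineK ?integrable_fin_num // lee_fin.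
have -> : fine (\int[mu]_(s in D) (Z s)%:E) =
  \int[mu]_(s in D) expR (1 * S s) + \int[mu]_(s in D) expR (-1 * S s) - 2.
  rewrite -[2]mulr1 -[X in _ - 2 * X]/(fine 1%:E) -muD -Rintegral_cst //.
  by rewrite -(RintegralD mD i1 i2) -(RintegralB mD i12 ic) -ZE.
(* Applied to [S] and to [- S]. With variance [del / 4] the moment is at most [exp (del / 2) <= 1 +
   del / 2 + del^2 / 2 <= 1 + del]. *)
have em b : b ^+ 2 = 1 -> \int[mu]_(s in D) expR (b * S s) <= 1 + del.
  move=> b2; apply: (@le_trans _ _ (expR (2 * (del / 4)))); last first.
    case/andP: del01 => d0 d1.
    have /expR_le_quadratic : `|2 * (del / 4)| <= 1 / 2 by rewrite ger0_norm; lra.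
    by move/le_trans; apply; nra.
  have := @exp_moment_le _ _ _ _ a (fun k => b * c k) (del / 4) mf indf mkap.
  under eq_Rintegral do under eq_bigr do rewrite -mulrA.
  under eq_Rintegral do rewrite -mulr_sumr.
  apply => //; first by case/andP: del01 => d0 d1; lra.
  by under eq_bigr do rewrite exprMn b2 mul1r.
have := em 1 (expr1n _ _); have := em (-1) _; rewrite sqrrN expr1n => /(_ erefl); lra.
Qed.

Lemma integral_abs_weighted_sum_le (F : set T) (nu A B : R) :
  measurable F -> F `<=` D -> (mu F <= (2 * nu)%:E)%E -> 0 <= A -> 0 <= B ->
  (forall t : R, `|t| <= A + B * (expR t + expR (- t) - 2)) ->
  (\int[mu]_(s in F) `|S s|%:E <= (2 * A * nu + 2 * B * del)%:E)%E.
Proof.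
move=> mF FD Fnu A0 B0 AB.
have mSF := measurable_funS mD FD mS; have mZF := measurable_funS mD FD mZ.
apply: (@le_trans _ _ (\int[mu]_(s in F) (A%:E + B%:E * (Z s)%:E))%E).
  apply: ge0_le_integral => //.
  by apply/measurable_EFinP; exact: measurableT_comp.
  apply/measurable_EFinP; apply: measurable_funD => //; exact: measurable_funM.
  by move=> s _; rewrite -EFinM -EFinD lee_fin.
rewrite ge0_integralD //; last 2 first.
  by move=> s _; rewrite -EFinM lee_fin mulr_ge0.
  by apply/measurable_EFinP; apply: measurable_funM.
rewrite integral_cst // ge0_integralZl //; last 2 first.
  exact/measurable_EFinP.
  by move=> s _; rewrite lee_fin.
rewrite EFinD; apply: leeD.
  by rewrite (le_trans (lee_wpmul2l _ Fnu)) // -EFinM lee_fin; lra.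
apply: (@le_trans _ _ (B%:E * (2 * del)%:E)%E); last by rewrite -EFinM lee_fin; lra.
apply: lee_wpmul2l => //; apply: le_trans integral_cosh_excess_le.
apply: ge0_subset_integral => //; first exact/measurable_EFinP.
by move=> s _; rewrite lee_fin.
Qed.

(** Here [L = log (del / nu)] may have either sign. The choice [lam = exp (L / 2)] balances the two
    terms, and the result is the Cauchy-Schwarz order [sqrt (nu * del)]. *)
Lemma integral_abs_weighted_sum_le_half (F : set T) (nu L : R) :
  measurable F -> F `<=` D -> (mu F <= (2 * nu)%:E)%E -> 0 <= nu ->
  del = nu * expR L ->
  (\int[mu]_(s in F) `|S s|%:E <= (4 * nu * expR (L / 2))%:E)%E.
Proof.
move=> mF FD Fnu nu0 dE.
have := @integral_abs_weighted_sum_le F nu _ _ mF FD Fnu (expR_ge0 (L / 2)) _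
  (fun t => @abs_le_cosh_excess _ _ t (expR_gt0 (L / 2))).
move=> h; apply: le_trans (h _) _; first by rewrite invr_ge0 expR_ge0.
rewrite lee_fin dE -expRN.
have -> : expR L = expR (L / 2) * expR (L / 2) by rewrite -expRD -splitr.
have := expRxMexpNx_1 (L / 2); move: (expR (L / 2)) (expR (- (L / 2))) => x y xy.
have -> : 2 * y * (nu * (x * x)) = 2 * nu * x * (x * y) by ring.
by rewrite xy; lra.
Qed.

(** For sets smaller than [del]. The two terms add up to at most [20 nu (1 + L)], and the linear
    factor is traded for a small exponential: [1 + L <= exp (eta L) / eta]. *)
Lemma integral_abs_weighted_sum_le_small (F : set T) (nu L eta : R) :
  measurable F -> F `<=` D -> (mu F <= (2 * nu)%:E)%E -> 0 <= nu ->
  del = nu * expR L -> 0 <= L -> 0 < eta <= 1 ->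
  (\int[mu]_(s in F) `|S s|%:E <= (20 / eta * nu * expR (eta * L))%:E)%E.
Proof.
move=> mF FD Fnu nu0 dE L0 /andP[e0 e1].
have := @integral_abs_weighted_sum_le F nu (2 * (1 + L)) (8 * expR (- L)) mF FD Fnu _ _
  (fun t => abs_le_log_cosh_excess t L0).
move=> h; apply: le_trans (h _ _) _.
  by lra.
  by rewrite mulr_ge0 ?expR_ge0.
rewrite lee_fin dE.
have -> : 2 * (8 * expR (- L)) * (nu * expR L) = 16 * nu * (expR L * expR (- L)) by ring.
rewrite expRxMexpNx_1.
have : 1 + eta * L <= expR (eta * L) := expR_ge1Dx (eta * L).
rewrite -(ler_pM2l (_ : 0 < 20 / eta)) ?divr_gt0 // => {}h.
have : 20 * (1 + L) <= 20 / eta * expR (eta * L).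
  apply: le_trans h; rewrite [leRHS]mulrDr mulr1 mulrA divfK ?gt_eqF // mulrDr lerD2r mulr1.
  by rewrite ler_pdivlMr //; lra.
by move/(ler_wpM2l nu0); have := mulr_ge0 nu0 L0; lra.
Qed.

End WeightedSum.

End ProbabilityMeasure.

(** * Rearrangements at dyadic points *)

Section Rearrangement.
Context d (T : measurableType d) (R : realType).
Variables (mu : {measure set T -> \bar R}) (D : set T).
Hypotheses (mD : measurable D) (muD : mu D = 1%E).
Implicit Types (x y : T -> R) (t : R).

Definition level_set x (tau : R) : set T := D `&` [set s | tau < `|x s|].

(* For Lebesgue measure on [0,1] this is convertible to [rearrangement]. *)
Definition rearr x t : R :=
  inf [set tau : R | 0 <= tau /\ (mu (level_set x tau) < t%:E)%E].

Lemma measurable_level_set x tau : measurable_fun D x -> measurable (level_set x tau).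
Proof.
move=> mx; have mnx : measurable_fun D (fun s => `|x s|) by exact: measurableT_comp.
rewrite [X in measurable X](_ : _ = D `&` (fun s => `|x s|) @^-1` `]tau, +oo[).
  exact: mnx.
by apply/seteqP; split => s /=; rewrite in_itv /= andbT.
Qed.

Lemma le_level_set x tau tau' : measurable_fun D x -> tau <= tau' ->
  (mu (level_set x tau') <= mu (level_set x tau))%E.
Proof.
move=> mx tt'; apply: le_measure; rewrite ?inE; try exact: measurable_level_set.
by move=> s [Ds ts]; split => //; exact: le_lt_trans ts.
Qed.

Let level_set_lty x tau : measurable_fun D x -> (mu (level_set x tau) < +oo)%E.
Proof.
move=> mx; apply: (@le_lt_trans _ _ (mu D)); last by rewrite muD ltry.
by apply: le_measure; rewrite ?inE //; [exact: measurable_level_set|move=> s []].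
Qed.

(** Ensures that the infimum defining [rearr] is not a default value: the level sets at integer
    heights decrease to the empty set, so their measures tend to 0. *)
Lemma rearr_nonempty x t : measurable_fun D x -> 0 < t ->
  [set tau : R | 0 <= tau /\ (mu (level_set x tau) < t%:E)%E] !=set0.
Proof.
move=> mx t0; pose F n := level_set x n%:R.
have F0 : \bigcap_n F n = set0.
  rewrite -subset0 => s /= Fs.
  have [_ /=] := Fs (Num.Def.truncn `|x s|).+1 Logic.I.
  by rewrite ltNge => /negP; apply; apply: ltW; exact: truncnS_gt.
have : mu \o F @ \oo --> 0%E.
  rewrite -(measure0 mu) -F0; apply: nonincreasing_cvg_mu => //.
  exact: level_set_lty.
  by move=> i; exact: measurable_level_set.
  by rewrite F0.
  move=> m n mn; apply/subsetPset => s [Ds ns]; split => //=.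
  by apply: le_lt_trans ns; rewrite ler_nat.
move=> F_cvg; apply: contrapT => h; have tF n : (t%:E <= mu (F n))%E.
  rewrite leNgt; apply/negP => Fn; apply: h; exists n%:R; split => //.
have : (t%:E <= lim (mu \o F @ \oo))%E.
  by apply: lime_ge; [apply/cvg_ex; exists 0%E|exact: nearW].
by rewrite (cvg_lim _ F_cvg) // lee_fin leNgt t0.
Qed.

Lemma rearr_ge0 x t : measurable_fun D x -> 0 < t -> 0 <= rearr x t.
Proof. by move=> mx t0; apply: lb_le_inf => [|tau []//]; exact: rearr_nonempty. Qed.

Lemma rearr_le x t tau : 0 <= tau -> (mu (level_set x tau) < t%:E)%E -> rearr x t <= tau.
Proof. by move=> tau0 h; apply: ge_inf; [exists 0 => ? []|split]. Qed.

Lemma level_set_lt x t tau : measurable_fun D x -> 0 < t -> rearr x t < tau ->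
  (mu (level_set x tau) < t%:E)%E.
Proof.
move=> mx t0 /(inf_lt (rearr_nonempty mx t0))[y [y0 yt] ytau].
exact: le_lt_trans (le_level_set mx (ltW ytau)) yt.
Qed.

Lemma level_set_ge x t tau : 0 <= tau -> tau < rearr x t ->
  (t%:E <= mu (level_set x tau))%E.
Proof. by move=> tau0; rewrite leNgt; apply: contraTN => /(rearr_le tau0); rewrite leNgt. Qed.

(** The infimum need not be attained, so the level set is exhausted from the heights
    [rearr x t + 1/(n+1)]; the strict inequality becomes a weak one in the limit. *)
Lemma level_set_rearr_le x t : measurable_fun D x -> 0 < t ->
  (mu (level_set x (rearr x t)) <= t%:E)%E.
Proof.
move=> mx t0; pose F n := level_set x (rearr x t + n.+1%:R^-1).
have FE : \bigcup_n F n = level_set x (rearr x t).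
  apply/seteqP; split => [s [n _ [Ds /= ns]]|s [Ds /= xs]].
    by split => //=; apply: lt_trans ns; rewrite ltrDl invr_gt0.
  have /ltr_add_invr[n xn] := xs; by exists n.
have Fcvg : mu \o F @ \oo --> mu (level_set x (rearr x t)).
  rewrite -FE; apply: nondecreasing_cvg_mu.
  by move=> n; exact: measurable_level_set.
  by rewrite FE; exact: measurable_level_set.
  move=> m n mn; apply/subsetPset => s [Ds /= ms]; split => //=.
  by apply: le_lt_trans ms; rewrite lerD2l lef_pV2 ?posrE // ler_nat.
rewrite -(cvg_lim _ Fcvg) //; apply: lime_le; first by apply/cvg_ex; eexists; exact: Fcvg.
by apply: nearW => n /=; apply/ltW/level_set_lt => //; rewrite ltrDl invr_gt0.
Qed.

Lemma rearr_anti x t t' : measurable_fun D x -> 0 < t -> t <= t' ->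
  rearr x t' <= rearr x t.
Proof.
move=> mx t0 tt'; apply/ler_addgt0Pr => e e0; apply: rearr_le.
  by rewrite addr_ge0 ?rearr_ge0 // ltW.
apply: (@lt_le_trans _ _ t%:E); last by rewrite lee_fin.
by apply: level_set_lt => //; rewrite ltrDl.
Qed.

Lemma rearrD_le x y t : measurable_fun D x -> measurable_fun D y -> 0 < t ->
  rearr (fun s => x s + y s) t <= rearr x (t / 2) + rearr y (t / 2).
Proof.
move=> mx my t0; have t20 : 0 < t / 2 by rewrite divr_gt0.
apply/ler_addgt0Pr => e e0.
pose a := rearr x (t / 2) + e / 2; pose b := rearr y (t / 2) + e / 2.
have -> : rearr x (t / 2) + rearr y (t / 2) + e = a + b by rewrite /a /b; lra.
have a0 : 0 <= a by rewrite addr_ge0 ?rearr_ge0 // divr_ge0 // ltW.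
have b0 : 0 <= b by rewrite addr_ge0 ?rearr_ge0 // divr_ge0 // ltW.
apply: rearr_le; first exact: addr_ge0.
apply: (@le_lt_trans _ _ (mu (level_set x a `|` level_set y b))).
  apply: le_measure; rewrite ?inE.
  by apply: measurable_level_set; exact: measurable_funD.
  by apply: measurableU; exact: measurable_level_set.
  move=> s [Ds /= xys]; have [ax|ax] := ltP a `|x s|; first by left.
  right; split => //=; rewrite ltNge; apply/negP => yb.
  by move: xys; rewrite ltNge (le_trans (ler_normD _ _)) // lerD.
apply: (@le_lt_trans _ _ (mu (level_set x a) + mu (level_set y b))%E).
  by apply: measureU2; exact: measurable_level_set.
rewrite [in ltRHS](splitr t) EFinD; apply: lteD.
  by apply: level_set_lt => //; rewrite ltrDl divr_gt0.
by apply: level_set_lt => //; rewrite ltrDl divr_gt0.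
Qed.

Lemma rearrZ_le x (r : R) t : measurable_fun D x -> 0 < t ->
  rearr (fun s => r * x s) t <= `|r| * rearr x t.
Proof.
move=> mx t0; apply/ler_addgt0Pr => e e0.
(* The added 1 covers [r = 0]. *)
pose eps := e / (`|r| + 1).
have r1 : 0 < `|r| + 1 by rewrite ltr_wpDl.
have eps0 : 0 < eps by rewrite divr_gt0.
have re : `|r| * eps <= e.
  by rewrite /eps mulrA ler_pdivrMr // mulrC ler_wpM2l ?lerDl // ltW.
apply: (@le_trans _ _ (`|r| * (rearr x t + eps))); last by rewrite mulrDr lerD2l.
apply: rearr_le; first by rewrite mulr_ge0 // addr_ge0 ?rearr_ge0 // ltW.
apply: le_lt_trans (@level_set_lt x t (rearr x t + eps) mx t0 _); last by rewrite ltrDl.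
apply: le_measure; rewrite ?inE.
  by apply: measurable_level_set; exact: measurable_funM.
  exact: measurable_level_set.
move=> s [Ds /=]; rewrite normrM => rs; split => //=.
rewrite ltNge; apply/negP => xs; move: rs; rewrite ltNge => /negP; apply.
exact: ler_wpM2l.
Qed.

Definition dyadic_rearr x i : R := rearr x (2^-1 ^+ i).

(* [|x| <= dyadic_rearr x i] on [dyadic_level x i] outside of
   [dyadic_level x i.+1]. *)
Definition dyadic_level x i : set T :=
  if i is j.+1 then level_set x (dyadic_rearr x j) else D.

Lemma dyadic_rearr_ge0 x i : measurable_fun D x -> 0 <= dyadic_rearr x i.
Proof. by move=> mx; rewrite rearr_ge0 // exprn_gt0. Qed.

Lemma measurable_dyadic_level x i : measurable_fun D x -> measurable (dyadic_level x i).
Proof. by case: i => [|i] //= mx; exact: measurable_level_set. Qed.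

Lemma dyadic_level_sub x i : dyadic_level x i `<=` D.
Proof. by case: i => [|i] //= s []. Qed.

Lemma mu_dyadic_level_le x i : measurable_fun D x ->
  (mu (dyadic_level x i) <= (2 * 2^-1 ^+ i)%:E)%E.
Proof.
case: i => [|i] mx /=; first by rewrite muD lee_fin expr0; lra.
apply: le_trans (level_set_rearr_le mx _) _; first exact: exprn_gt0.
by rewrite lee_fin exprS mulrA divff // mul1r.
Qed.

(** A point that leaves the nested levels has a last level [k], where [|x s| <= dyadic_rearr x k],
    so the term of index [k] alone dominates. Points lying in all levels form a null set, since the
    measures of the levels tend to 0. *)
Lemma integral_abs_mul_dyadic_le x (phi : T -> R) :
  measurable_fun D x -> measurable_fun D phi -> (forall s, 0 <= phi s) ->
  (\int[mu]_(s in D) (`|x s| * phi s)%:E <=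
   \sum_(i <oo) (dyadic_rearr x i)%:E * \int[mu]_(s in dyadic_level x i) (phi s)%:E)%E.
Proof.
move=> mx mphi phi0.
have h0 i : 0 <= dyadic_rearr x i by exact: dyadic_rearr_ge0.
pose g i s : \bar R := (dyadic_rearr x i * (phi s * \1_(dyadic_level x i) s))%:E.
have g0 i s : (0 <= g i s)%E by rewrite lee_fin !mulr_ge0.
have mg i : measurable_fun D (g i).
  apply/measurable_EFinP; apply: measurable_funM => //; apply: measurable_funM => //.
  by apply: measurable_indic; exact: measurable_dyadic_level.
have gE i : (\int[mu]_(s in D) g i s =
    (dyadic_rearr x i)%:E * \int[mu]_(s in dyadic_level x i) (phi s)%:E)%E.
  rewrite /g; under eq_integral do rewrite EFinM.
  rewrite ge0_integralZl_EFin //; last 2 first.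
    by move=> s _; rewrite lee_fin mulr_ge0.
    apply/measurable_EFinP; apply: measurable_funM => //.
    by apply: measurable_indic; exact: measurable_dyadic_level.
  congr (_ * _)%E; rewrite -[in RHS](setIidr (@dyadic_level_sub x i)) integral_mkcondr.
  apply: eq_integral => s _; rewrite patchE indicE.
  by case: (s \in _); rewrite ?mulr1 ?mulr0.
under eq_eseriesr do rewrite -gE.
rewrite -integral_nneseries //.
apply: ae_ge0_le_integral => //.
  by move=> s _; rewrite lee_fin mulr_ge0.
  apply/measurable_EFinP; apply: measurable_funM => //; exact: measurableT_comp.
  by move=> s _; exact: nneseries_ge0.
  exact: ge0_emeasurable_sum.
have mG : measurable (\bigcap_i dyadic_level x i).
  by apply: bigcap_measurableType => i _; exact: measurable_dyadic_level.
exists (\bigcap_i dyadic_level x i); split => //.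
  apply/eqP; rewrite eq_le measure_ge0 andbT.
  apply/lee_addgt0Pr => e e0; rewrite add0e.
  have e20 : 0 < e / 2 by rewrite divr_gt0.
  have [n _ /(_ n (leqnn n))] := near_infty_natSinv_expn_lt (PosNum e20).
  rewrite /= mul1r => ne.
  apply: (@le_trans _ _ (mu (dyadic_level x n))).
    apply: le_measure; rewrite ?inE //; first exact: measurable_dyadic_level.
    exact: bigcap_inf.
  apply: le_trans (mu_dyadic_level_le n mx) _; rewrite lee_fin exprVn.
  by rewrite mulrC -ler_pdivlMr // ltW.
move=> s /= /not_implyP[Ds ns] i _; apply: contrapT => nFi; apply: ns.
have [k [xk Fk]] : exists k, `|x s| <= dyadic_rearr x k /\ dyadic_level x k s.
  elim: i nFi => [//|i IHi] nFi.
  have [Fi|/IHi//] := pselect (dyadic_level x i s).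
  exists i; split => //; rewrite leNgt; apply/negP => h; apply: nFi.
  by split.
apply: (@le_trans _ _ (g k s)).
  rewrite lee_fin indicE mem_set // mulr1; exact: ler_wpM2r.
apply: le_trans (nneseries_lim_ge k.+1 _) => [|n _ _]; last exact: g0.
rewrite big_mkord big_ord_recr /= leeDr //.
by apply: sume_ge0 => n _; exact: g0.
Qed.

Variables (p q : R).
Hypothesis (q1 : 1 <= q).

(* [t ^ (1 / p) x^*(t)] at [t = 2^-i]; the [L_{p,q}] functional is comparable
   to the [l_q] norm of this sequence, whose [q]-th power is [dyadic_sum]. *)
Definition dyadic_coef x i : R := dyadic_rearr x i * (2^-1 ^+ i) `^ p^-1.

Definition dyadic_sum x : \bar R := (\sum_(i <oo) (dyadic_coef x i `^ q)%:E)%E.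

Lemma dyadic_coef_ge0 x i : measurable_fun D x -> 0 <= dyadic_coef x i.
Proof. by move=> mx; rewrite mulr_ge0 ?powR_ge0 ?dyadic_rearr_ge0. Qed.

Lemma dyadic_sum_ge0 x : (0 <= dyadic_sum x)%E.
Proof. by apply: nneseries_ge0 => i _ _; rewrite lee_fin powR_ge0. Qed.

Lemma dyadic_coef_powR x i : measurable_fun D x ->
  dyadic_coef x i `^ q = dyadic_rearr x i `^ q * (2^-1 ^+ i) `^ (q / p).
Proof.
move=> mx; rewrite powRM ?powR_ge0 ?dyadic_rearr_ge0 //.
by rewrite -powRrM (mulrC q).
Qed.

Let q0 : 0 < q. Proof. exact: lt_le_trans q1. Qed.

(** The rearrangement of a sum is controlled at half the argument: the dyadic index moves by one, at
    the price of [2^(1/p)]. *)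
Lemma dyadic_coefD_le x y i : measurable_fun D x -> measurable_fun D y ->
  dyadic_coef (fun s => x s + y s) i <=
    2 `^ p^-1 * (dyadic_coef x i.+1 + dyadic_coef y i.+1).
Proof.
move=> mx my.
have e : 2^-1 ^+ i = 2 * 2^-1 ^+ i.+1 :> R by rewrite exprS mulrA divff ?mul1r.
have h := rearrD_le mx my (exprn_gt0 i (_ : 0 < 2^-1)).
rewrite /dyadic_coef -mulrDl mulrCA -powRM ?exprn_ge0 // -e ler_wpM2r ?powR_ge0 //.
by rewrite /dyadic_rearr; apply: le_trans (h _) _ => //; rewrite -exprSr.
Qed.

(** Closure of [L_{p,q}] under addition will follow from this, although for [q > p] its functional
    is not subadditive. *)
Lemma dyadic_sumD_lty x y : measurable_fun D x -> measurable_fun D y ->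
  (dyadic_sum x < +oo)%E -> (dyadic_sum y < +oo)%E ->
  (dyadic_sum (fun s => x s + y s)%R < +oo)%E.
Proof.
move=> mx my xoo yoo; have mxy := measurable_funD mx my.
have shift z : (dyadic_sum z < +oo -> \sum_(i <oo) (dyadic_coef z i.+1 `^ q)%:E < +oo)%E.
  apply: le_lt_trans; apply: (@nneseries_shift_le _ (fun i => (dyadic_coef z i `^ q)%:E)).
  by move=> i; rewrite lee_fin powR_ge0.
pose c := 2 `^ q * (2 `^ p^-1) `^ q.
apply: (@le_lt_trans _ _ (c%:E * (\sum_(i <oo) (dyadic_coef x i.+1 `^ q)%:E +
    \sum_(i <oo) (dyadic_coef y i.+1 `^ q)%:E))%E); last first.
  apply: lte_mul_pinfty; [by rewrite lee_fin mulr_ge0 ?powR_ge0|by []|].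
  exact: lte_add_pinfty (shift x xoo) (shift y yoo).
rewrite -nneseriesD; last 2 first.
  by move=> i _ _; rewrite lee_fin powR_ge0.
  by move=> i _ _; rewrite lee_fin powR_ge0.
rewrite -nneseriesZl; last by move=> i _; rewrite -EFinD lee_fin addr_ge0 ?powR_ge0.
apply: lee_nneseries => i; first by rewrite lee_fin powR_ge0.
move=> _; rewrite -EFinD -EFinM lee_fin.
have xi := dyadic_coef_ge0 i.+1 mx; have yi := dyadic_coef_ge0 i.+1 my.
apply: (@le_trans _ _ ((2 `^ p^-1 * (dyadic_coef x i.+1 + dyadic_coef y i.+1)) `^ q)).
  apply: ge0_ler_powR; rewrite ?nnegrE ?(ltW q0) ?dyadic_coefD_le //.
  exact: dyadic_coef_ge0.
  by rewrite mulr_ge0 ?powR_ge0 // addr_ge0.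
rewrite powRM ?powR_ge0 ?addr_ge0 // /c (mulrC (2 `^ q)) -mulrA.
by rewrite ler_wpM2l ?powR_ge0 // powRD_le // ltW.
Qed.

Lemma dyadic_sumZ_le x (r : R) : measurable_fun D x ->
  (dyadic_sum (fun s => r * x s)%R <= (`|r| `^ q)%:E * dyadic_sum x)%E.
Proof.
move=> mx; have mrx : measurable_fun D (fun s => r * x s) by exact: measurable_funM.
rewrite -nneseriesZl; last by move=> i _; rewrite lee_fin powR_ge0.
apply: lee_nneseries => i; first by rewrite lee_fin powR_ge0.
move=> _; rewrite -EFinM lee_fin -powRM ?dyadic_coef_ge0 //.
apply: ge0_ler_powR; rewrite ?nnegrE ?(ltW q0) ?dyadic_coef_ge0 //.
  by rewrite mulr_ge0 ?dyadic_coef_ge0.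
by rewrite mulrA ler_wpM2r ?powR_ge0 // rearrZ_le // exprn_gt0.
Qed.

Lemma dyadic_sumZ_lty x (r : R) : measurable_fun D x ->
  (dyadic_sum x < +oo)%E -> (dyadic_sum (fun s => r * x s)%R < +oo)%E.
Proof.
move=> mx xoo; apply: le_lt_trans (dyadic_sumZ_le r mx) _.
by apply: lte_mul_pinfty => //; rewrite lee_fin powR_ge0.
Qed.

End Rearrangement.

(** * Integration of nonincreasing functions against [d(t^rho)] over dyadic intervals *)

Section DyadicStieltjes.
Context {R : realType}.
Variable rho : R.
Hypothesis rho0 : 0 < rho.

Definition dyadic_itv i : set R := `]2^-1 ^+ i.+1, 2^-1 ^+ i]%classic.

Lemma dyadic_itvE i (t : R) : dyadic_itv i t = (2^-1 ^+ i.+1 < t <= 2^-1 ^+ i).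
Proof. by rewrite /dyadic_itv /= in_itv. Qed.

Lemma half_expn_gt0 i : 0 < 2^-1 ^+ i :> R. Proof. exact: exprn_gt0. Qed.

Lemma half_expn_le i j : (i <= j)%N -> 2^-1 ^+ j <= 2^-1 ^+ i :> R.
Proof. by move=> ij; rewrite ler_wiXn2l // invf_le1 // ler1n. Qed.

Lemma bigcup_dyadic_itv : \bigcup_i dyadic_itv i = `]0%R, 1%R]%classic.
Proof.
apply/seteqP; split => [t [i _]|t].
  rewrite dyadic_itvE /= in_itv /= => /andP[t0 t1].
  by rewrite (lt_trans _ t0) ?half_expn_gt0 //= (le_trans t1) // (half_expn_le (leq0n i)).
rewrite /= in_itv /= => /andP[t0 t1].
have [n ltn] : exists n, 2^-1 ^+ n < t.
  have [n _ /(_ n (leqnn n))] := near_infty_natSinv_expn_lt (PosNum t0).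
  by rewrite /= mul1r -exprVn; exists n.
elim: n ltn => [|n IHn] ltn; first by rewrite expr0 in ltn; lra.
have [/IHn//|tn] := ltP (2^-1 ^+ n) t.
by exists n => //; rewrite dyadic_itvE ltn tn.
Qed.

Lemma trivIset_dyadic_itv : trivIset setT dyadic_itv.
Proof.
apply: ltn_trivIset => m n mn; rewrite -subset0 => t []; rewrite !dyadic_itvE.
move=> /andP[tm _] /andP[_ tn].
by have := le_trans tn (half_expn_le mn); rewrite leNgt tm.
Qed.

Lemma stieltjes_dyadic_itv i :
  lebesgue_stieltjes_measure (pow_cumul rho) (dyadic_itv i) =
  ((1 - 2^-1 `^ rho) * (2^-1 ^+ i) `^ rho)%:E.
Proof.
rewrite /lebesgue_stieltjes_measure/= /measure_extension measurable_mu_extE /=; last first.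
  exact: is_ocitv.
rewrite wlength_itv_bnd /=; last exact: half_expn_le.
rewrite /pow_cumul gtr0_norm // !max_r ?(ltW (half_expn_gt0 _)) //.
by rewrite exprS powRM ?(ltW (half_expn_gt0 _)) // mulrBl mul1r.
Qed.

Variable G : R -> R.
Hypothesis G0 : forall t : R, 0 < t -> 0 <= G t.
Hypothesis G_anti : forall t t' : R, 0 < t -> t <= t' -> G t' <= G t.

Lemma measurable_dyadic_itv_anti i :
  measurable_fun (dyadic_itv i : set (measurableTypeR R)) G.
Proof.
(* [G] is known to be monotone only for positive arguments; cutting the argument off at the left
   endpoint gives a function monotone on the whole line. *)
apply: (@eq_measurable_fun _ _ _ _ _ (fun t : R => G (Num.max (2^-1 ^+ i.+1) t))).
  move=> t; rewrite inE dyadic_itvE => /andP[t0 _].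
  by rewrite max_r // ltW.
apply: nonincreasing_measurable; first exact: measurable_itv.
move=> s t st; apply: G_anti; first by rewrite lt_max half_expn_gt0.
by rewrite ge_max !le_max lexx st orbT.
Qed.

Let M := lebesgue_stieltjes_measure (pow_cumul rho).

Let integral_dyadicE : (\int[M]_(t in `]0%R, 1%R]) (G t)%:E =
  \sum_(i <oo) \int[M]_(t in dyadic_itv i) (G t)%:E)%E.
Proof.
rewrite -bigcup_dyadic_itv ge0_integral_bigcup //.
by move=> k; exact: measurable_itv.
apply/measurable_EFinP/measurable_fun_bigcup => k; first exact: measurable_itv.
exact: measurable_dyadic_itv_anti.
rewrite bigcup_dyadic_itv => t /=; rewrite in_itv /= => /andP[t0 _].
by rewrite lee_fin G0.
exact: trivIset_dyadic_itv.
Qed.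

Let A i : \bar R := (G (2^-1 ^+ i) * (2^-1 ^+ i) `^ rho)%:E.

Let A_ge0 i : (0 <= A i)%E.
Proof. by rewrite lee_fin mulr_ge0 ?G0 ?powR_ge0 ?half_expn_gt0. Qed.

Let kap_gt0 : 0 < 1 - 2^-1 `^ rho :> R.
Proof. by rewrite subr_gt0 half_powR_lt1. Qed.

Let G_itv_bounds i (t : R) : dyadic_itv i t ->
  G (2^-1 ^+ i) <= G t <= G (2^-1 ^+ i.+1).
Proof.
rewrite dyadic_itvE => /andP[t1 t2].
have t0 : 0 < t := lt_trans (half_expn_gt0 _) t1.
by rewrite !G_anti ?half_expn_gt0 // ltW.
Qed.

Let integral_cst_dyadic_itv i (c : R) :
  (\int[M]_(t in dyadic_itv i) c%:E = (c * ((1 - 2^-1 `^ rho) * (2^-1 ^+ i) `^ rho))%:E)%E.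
Proof.
transitivity (c%:E * M (dyadic_itv i))%E; last by rewrite /M stieltjes_dyadic_itv.
by apply: integral_cst; exact: measurable_itv.
Qed.

Lemma integral_dyadic_ge :
  ((1 - 2^-1 `^ rho)%:E * \sum_(i <oo) (G (2^-1 ^+ i) * (2^-1 ^+ i) `^ rho)%:E
    <= \int[M]_(t in `]0%R, 1%R]) (G t)%:E)%E.
Proof.
rewrite -nneseriesZl; last by move=> i _; exact: A_ge0.
rewrite integral_dyadicE; apply: lee_nneseries => i.
  by move=> _ _; rewrite mule_ge0 ?A_ge0 // lee_fin ltW.
move=> _; rewrite -EFinM mulrCA -integral_cst_dyadic_itv.
apply: ge0_le_integral.
  exact: measurable_itv.
  by move=> t _; rewrite lee_fin G0 ?half_expn_gt0.
  by apply/measurable_EFinP.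
  by apply/measurable_EFinP; exact: measurable_dyadic_itv_anti.
by move=> t /G_itv_bounds/andP[]; rewrite lee_fin.
Qed.

(** On a dyadic interval [G] is at most its value at the left endpoint, which is the next dyadic
    point; rescaling the weight to that index costs [2^rho]. *)
Lemma integral_dyadic_le :
  (\int[M]_(t in `]0%R, 1%R]) (G t)%:E <= ((1 - 2^-1 `^ rho) * 2 `^ rho)%:E *
     \sum_(i <oo) (G (2^-1 ^+ i) * (2^-1 ^+ i) `^ rho)%:E)%E.
Proof.
apply: (@le_trans _ _ (\sum_(i <oo) (((1 - 2^-1 `^ rho) * 2 `^ rho)%:E * A i.+1))%E).
  rewrite integral_dyadicE; apply: lee_nneseries => i.
    move=> _ _; apply: integral_ge0 => t; rewrite dyadic_itvE => /andP[t0 _].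
    by rewrite lee_fin G0 // (lt_trans _ t0) ?half_expn_gt0.
  move=> _; rewrite -EFinM.
  have -> : (1 - 2^-1 `^ rho) * 2 `^ rho * (G (2^-1 ^+ i.+1) * (2^-1 ^+ i.+1) `^ rho) =
      G (2^-1 ^+ i.+1) * ((1 - 2^-1 `^ rho) * (2^-1 ^+ i) `^ rho).
    have -> : 2^-1 ^+ i = 2 * 2^-1 ^+ i.+1 :> R by rewrite exprS mulrA divff ?mul1r.
    by rewrite powRM ?(ltW (half_expn_gt0 _)) //; ring.
  rewrite -integral_cst_dyadic_itv; apply: ge0_le_integral.
    exact: measurable_itv.
    move=> t; rewrite dyadic_itvE => /andP[t0 _].
    by rewrite lee_fin G0 // (lt_trans _ t0) ?half_expn_gt0.
    by apply/measurable_EFinP; exact: measurable_dyadic_itv_anti.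
    by apply/measurable_EFinP.
  by move=> t /G_itv_bounds/andP[]; rewrite lee_fin.
rewrite nneseriesZl; last by move=> i _; exact: A_ge0.
apply: lee_wpmul2l; first by rewrite lee_fin mulr_ge0 ?powR_ge0 // ltW.
exact: nneseries_shift_le A_ge0.
Qed.

End DyadicStieltjes.

(** * The Lorentz space and its functional in dyadic form *)

Section LorentzDyadic.
Context {R : realType}.
Variables (p q : R).
Hypotheses (p0 : 0 < p) (q1 : 1 <= q).

Local Notation m := (@completed_lebesgue_measure R).
Local Notation I := (@I01 R).

Lemma measurable_I01 : measurable I.
Proof. by apply: sub_caratheodory; exact: measurable_itv. Qed.

Lemma mu_I01 : (m I = 1)%E.
Proof.
have := lebesgue_measure_itv `[0%R : R, 1%R].
by rewrite /= lte_fin ltr01 oppr0 adde0.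
Qed.

Let q0 : 0 < q. Proof. exact: lt_le_trans q1. Qed.
Let rho0 : 0 < q / p. Proof. exact: divr_gt0. Qed.

Let lorentz_integral (x : lebR R -> R) : \bar R :=
  (\int[lebesgue_stieltjes_measure (pow_cumul (q / p))]_(t in `]0%R, 1%R])
      ((rearrangement x t) `^ q)%:E)%E.

Let kap := 1 - 2^-1 `^ (q / p) : R.

Let kap0 : 0 < kap. Proof. by rewrite subr_gt0 half_powR_lt1. Qed.

Let lorentz_integral_bounds (x : lebR R -> R) : measurable_fun I x ->
  (kap%:E * dyadic_sum m I p q x <= lorentz_integral x
     <= (kap * 2 `^ (q / p))%:E * dyadic_sum m I p q x)%E.
Proof.
move=> mx; pose G (t : R) := rearrangement x t `^ q.
have x0 (t : R) : 0 < t -> 0 <= rearrangement x t :=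
  rearr_ge0 measurable_I01 mu_I01 mx (t := t).
have G0 (t : R) : 0 < t -> 0 <= G t by move=> _; exact: powR_ge0.
have Ganti (t t' : R) : 0 < t -> t <= t' -> G t' <= G t.
  move=> t0 tt'; apply: ge0_ler_powR; rewrite ?nnegrE ?(ltW q0) ?x0 //.
    exact: lt_le_trans tt'.
  exact: (rearr_anti measurable_I01 mu_I01 mx).
have SE : dyadic_sum m I p q x =
    (\sum_(i <oo) (G (2^-1 ^+ i) * (2^-1 ^+ i) `^ (q / p))%:E)%E.
  apply: eq_eseriesr => i _; rewrite (dyadic_coef_powR measurable_I01 mu_I01) //.
by rewrite SE integral_dyadic_ge //= integral_dyadic_le.
Qed.

Let lorentz_integral_ge0 (x : lebR R -> R) : (0 <= lorentz_integral x)%E.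
Proof. by apply: integral_ge0 => t _; rewrite lee_fin powR_ge0. Qed.

Lemma lorentz_space_dyadicE (x : lebR R -> R) : lorentz_space p q x <->
  measurable_fun I x /\ (dyadic_sum m I p q x < +oo)%E.
Proof.
split=> [[mx xoo]|[mx xoo]]; split => //.
  have Loo : (lorentz_integral x < +oo)%E.
    rewrite ltey; apply: contraTN xoo => /eqP Ly.
    by rewrite /lorentz_functional -/(lorentz_integral x) Ly poweRyr ?invr_eq0 ?gt_eqF // ltxx.
  have /andP[h _] := lorentz_integral_bounds mx.
  rewrite ltey; apply/eqP => Sy; move: (le_lt_trans h Loo).
  by rewrite Sy gt0_muley ?lte_fin // ltxx.
have /andP[_ h] := lorentz_integral_bounds mx.
apply: poweR_lty; apply: le_lt_trans h _; apply: lte_mul_pinfty => //.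
by rewrite lee_fin mulr_ge0 ?powR_ge0 // ltW.
Qed.

Lemma lorentz_functional_dyadic : exists c C : R, [/\ 0 < c, 0 < C &
  forall x : lebR R -> R, lorentz_space p q x ->
    c * fine (dyadic_sum m I p q x) `^ q^-1 <= fine (lorentz_functional p q x)
      <= C * fine (dyadic_sum m I p q x) `^ q^-1].
Proof.
exists (kap `^ q^-1), ((kap * 2 `^ (q / p)) `^ q^-1).
split; [exact: powR_gt0|by apply: powR_gt0; rewrite mulr_gt0 ?powR_gt0|].
move=> x /lorentz_space_dyadicE[mx Soo].
have := lorentz_integral_bounds mx.
have Sfin : dyadic_sum m I p q x \is a fin_num by rewrite ge0_fin_numE ?dyadic_sum_ge0.
rewrite -[dyadic_sum m I p q x in X in X -> _](fineK Sfin) -!EFinM.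
have S0 := fine_ge0 (dyadic_sum_ge0 m I p q x); move: (fine _) S0 => S S0.
rewrite /lorentz_functional -/(lorentz_integral x).
have := lorentz_integral_ge0 x; case: (lorentz_integral x) => [L||] //; last first.
  by move=> _ /andP[_]; rewrite leNgt ltry.
rewrite !lee_fin poweR_EFin /= => L0 /andP[h1 h2].
have k2 : 0 <= kap * 2 `^ (q / p) by rewrite mulr_ge0 ?powR_ge0 // ltW.
rewrite -!powRM ?(ltW kap0) //; apply/andP; split; apply: ge0_ler_powR;
  by rewrite ?nnegrE ?invr_ge0 ?mulr_ge0 // ltW.
Qed.

End LorentzDyadic.

(** * Functions biorthogonal to independent functions *)

Section IndependentIntegral.
Context d (T : measurableType d) (R : realType).
Variables (mu : {measure set T -> \bar R}) (D : set T) (mD : measurable D).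

(* [mu] restricted to [F] and pushed forward along [g] is compared away from
   [0], where it does not see the points outside of [F]. *)
Lemma integral_comp_pushforward (F : set T) (g : T -> R) (h : R -> \bar R)
    (mF : measurable F) (mg : measurable_fun F g) (mh : measurable_fun setT h) :
  (forall y, 0 <= h y)%E -> h 0 = 0%E ->
  (\int[mu]_(s in F) h (g s) =
   \int[pushforward mu (g \_ F)]_(y in ~` [set 0%R]) h y)%E.
Proof.
move=> h0 h00; have mgF : measurable_fun setT (g \_ F).
  exact/(measurable_restrictT _ _).1.
have -> : (\int[mu]_(s in F) h (g s) = \int[mu]_s h ((g \_ F) s))%E.
  rewrite integral_mkcond; apply: eq_integral => s _; rewrite !patchE.
  by case: (s \in F).
rewrite -[LHS]/(\int[mu]_(s in (g \_ F) @^-1` setT) (h \o (g \_ F)) s)%E.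
rewrite -ge0_integral_pushforward //.
rewrite -[~` _ in RHS]setTI integral_mkcondr; apply: eq_integral => y _.
by rewrite patchE; case: ifPn => //; rewrite notin_setE /= => /contrapT ->.
Qed.

(** The hypothesis says that the law of [g] under [mu] restricted to [E] is [c] times its law under
    [mu], so the integrals of functions of [g] scale by [c]. *)
Lemma ge0_integral_independent (E : set T) (g : T -> R) (c : {nonneg R})
    (h : R -> \bar R) :
  measurable (D `&` E) -> measurable_fun D g -> measurable_fun setT h ->
  (forall y, 0 <= h y)%E -> h 0 = 0%E ->
  (forall A, measurable A ->
     mu (D `&` E `&` g @^-1` A) = (c%:num%:E * mu (D `&` g @^-1` A))%E) ->
  (\int[mu]_(s in D `&` E) h (g s) = c%:num%:E * \int[mu]_(s in D) h (g s))%E.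
Proof.
move=> mDE mg mh h0 h00 indE.
have mgE : measurable_fun (D `&` E) g by apply: measurable_funS mg => //; exact: subIsetl.
have mgD' : measurable_fun setT (g \_ D) by exact/(measurable_restrictT _ _).1.
have mgE' : measurable_fun setT (g \_ (D `&` E)) by exact/(measurable_restrictT _ _).1.
rewrite !integral_comp_pushforward // -(ge0_integral_mscale _ _ c) //.
  2: by apply: measurableC; exact: measurable_set1.
  2: exact: measurable_funTS.
apply: eq_measure_integral => A mA A0.
have preE (F : set T) : (g \_ F) @^-1` A = F `&` g @^-1` A.
  apply/seteqP; split => s /=; rewrite patchE.
    by case: ifPn => [/set_mem Fs As //|_ /A0[]].
  by move=> [Fs As]; rewrite mem_set.
by have := indE A mA; rewrite -(preE (D `&` E)) -(preE D).
Qed.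

(** Here [g] may be unbounded, so its positive and negative parts are treated separately through its
    law; mean zero makes their integrals equal, and restriction to [E] scales both by
    [mu (D & E)]. *)
Lemma Rintegral_independent_mean_zero (E : set T) (g : T -> R) :
  measurable (D `&` E) -> mu.-integrable D (EFin \o g) ->
  (\int[mu]_(s in D) (g s)%:E = 0)%E -> mu (D `&` E) \is a fin_num ->
  (forall A, measurable A ->
     mu (D `&` E `&` g @^-1` A) = (mu (D `&` E) * mu (D `&` g @^-1` A))%E) ->
  \int[mu]_(s in D) (g s * \1_E s) = 0.
Proof.
move=> mDE ig g0 fE indE; have mg : measurable_fun D g.
  by apply/measurable_EFinP; exact: (measurable_int mu).
have c0 : 0 <= fine (mu (D `&` E)) by apply: fine_ge0; exact: measure_ge0.
pose c := NngNum c0.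
have cE : mu (D `&` E) = c%:num%:E by rewrite /= fineK.
have mpos : measurable_fun setT (fun y : R => (Num.max y 0)%:E).
  by apply/measurable_EFinP; apply: measurable_funTS; exact: measurable_maxr.
have mneg : measurable_fun setT (fun y : R => (Num.max (- y) 0)%:E).
  by apply/measurable_EFinP; apply: measurable_maxr.
have indE' A : measurable A ->
    mu (D `&` E `&` g @^-1` A) = (c%:num%:E * mu (D `&` g @^-1` A))%E.
  by rewrite -cE; exact: indE.
rewrite /Rintegral.
have -> : (\int[mu]_(s in D) (g s * \1_E s)%:E = \int[mu]_(s in D `&` E) (g s)%:E)%E.
  rewrite integral_mkcondr; apply: eq_integral => s _; rewrite patchE indicE.
  by case: (s \in E); rewrite ?mulr1 ?mulr0.
have posE : (fun s => (g s)%:E)^\+%E = fun s => (Num.max (g s) 0)%:E.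
  by apply/funext => s; rewrite funeposE -EFin_max.
have negE : (fun s => (g s)%:E)^\-%E = fun s => (Num.max (- g s) 0)%:E.
  by apply/funext => s; rewrite funenegE -EFinN -EFin_max.
have := integralE mu D (fun s => (g s)%:E); rewrite g0 posE negE.
have fp := integrable_pos_fin_num mD ig; have fn := integrable_neg_fin_num mD ig.
rewrite -[X in X^\+%E]/(fun s => (g s)%:E) posE in fp.
rewrite -[X in X^\-%E]/(fun s => (g s)%:E) negE in fn.
move: fp fn; set X := (\int[mu]_(s in D) (Num.max (g s) 0)%:E)%E.
set Y := (\int[mu]_(s in D) (Num.max (- g s) 0)%:E)%E => fp fn XY.
have {}XY : X = Y.
  by apply/esym; rewrite -[LHS]add0e XY subeK.
rewrite integralE posE negE.
have P := @ge0_integral_independent E g c _ mDE mg mpos _ _ indE'.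
have N := @ge0_integral_independent E g c _ mDE mg mneg _ _ indE'.
rewrite P ?N ?maxxx ?oppr0 ?maxxx // => [|y|y]; rewrite ?lee_fin ?le_max ?lexx ?orbT //.
by rewrite -/X -/Y XY subee // fin_numM.
Qed.
End IndependentIntegral.

(** * A test function for a single dyadic height *)

Section DualStep.
Context d (T : measurableType d) (R : realType).
Variables (mu : {measure set T -> \bar R}) (D : set T).
Hypotheses (mD : measurable D) (muD : mu D = 1%E).

(** The outcomes of the two threshold tests form a finite type, which puts every function of the
    truncated sign into the form [a \o kap \o f] used for independence. *)
Definition sign_class (tau y : R) : bool * bool := (tau < y, y < - tau).

Lemma measurable_sign_class tau v : measurable (sign_class tau @^-1` [set v]).
Proof.
have m1 (b : bool) : measurable [set y : R | (tau < y) = b].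
  case: b; [rewrite [X in measurable X](_ : _ = `]tau, +oo[%classic)|
            rewrite [X in measurable X](_ : _ = `]-oo, tau]%classic)] => //.
    by apply/seteqP; split => y /=; rewrite in_itv /= andbT.
  by apply/seteqP; split => y /=; rewrite in_itv /= leNgt; [move=> ->|move/negbTE].
have m2 (b : bool) : measurable [set y : R | (y < - tau) = b].
  case: b; [rewrite [X in measurable X](_ : _ = `]-oo, - tau[%classic)|
            rewrite [X in measurable X](_ : _ = `[- tau, +oo[%classic)] => //.
  by apply/seteqP; split => y /=; rewrite in_itv /= andbT leNgt; [move=> ->|move/negbTE].
rewrite [X in measurable X](_ : _ =
  [set y | (tau < y) = v.1] `&` [set y | (y < - tau) = v.2]).
  exact: measurableI.
by case: v => v1 v2; apply/seteqP; split => y /=; rewrite /sign_class => -[-> ->].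
Qed.

Lemma bounded_mul_integrable (x w : T -> R) (M : R) :
  mu.-integrable D (EFin \o x) -> measurable_fun D w -> (forall s, `|w s| <= M) ->
  mu.-integrable D (EFin \o (fun s => x s * w s)).
Proof.
move=> ix mw wM.
have bw : [bounded w s | s in D].
  exists M; split; first exact: num_real.
  by move=> y My s Ds; exact: le_trans (wM s) (ltW My).
have := integrableMl mD ix mw bw.
by apply: eq_integrable => // s _; rewrite /= EFinM.
Qed.

(* [a] is the sign of [x] truncated at the height [rearr mu D x t / 2], scaled
   to have [L_1] norm [t], then centred and divided by 4. *)
Lemma exists_dual_step (x : T -> R) (t : R) :
  measurable_fun D x -> mu.-integrable D (EFin \o x) ->
  \int[mu]_(s in D) x s = 0 -> 0 < t <= 1 ->
  exists tau (a : bool * bool -> R),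
    [/\ forall v, `|a v| <= 1 / 2,
        \int[mu]_(s in D) a (sign_class tau (x s)) = 0,
        \int[mu]_(s in D) (a (sign_class tau (x s))) ^+ 2 <= t / 4 &
        rearr mu D x t * t / 8 <= \int[mu]_(s in D) (x s * a (sign_class tau (x s)))].
Proof.
move=> mx ix x0 /andP[t0 t1].
(* If the rearrangement vanishes at [t], the zero function works, and no division by the measure of
   a possibly null level set arises. *)
have [r0|r_neq0] := eqVneq (rearr mu D x t) 0.
  exists 0, (fun=> 0); split.
  by move=> v; rewrite normr0 divr_ge0.
  by rewrite Rintegral_cst // mul0r.
  by rewrite expr0n Rintegral_cst // mul0r divr_ge0 // ltW.
  by under [leRHS]eq_Rintegral do rewrite mulr0; rewrite Rintegral_cst // r0 !mul0r.
set r := rearr mu D x t in r_neq0 *.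
have r0 : 0 < r by rewrite lt_neqAle eq_sym r_neq0 rearr_ge0.
(* Strictly below [r] the level set has measure at least [t], which may fail at [r] itself; hence
   the scaling factor [th] is at most 1. *)
pose tau := r / 2; have tau0 : 0 < tau by rewrite divr_gt0.
have mlev : measurable (level_set D x tau) := measurable_level_set mD tau mx.
have levfin : mu (level_set D x tau) \is a fin_num.
  by apply: (mu_sub_fin_num mD muD mlev) => s [].
pose lev := fine (mu (level_set D x tau)).
have levt : t <= lev.
  rewrite -lee_fin /lev fineK //; apply: level_set_ge; first exact: ltW.
  by rewrite -/r /tau; lra.
have lev0 : 0 < lev := lt_le_trans t0 levt.
pose th := t / lev; have th0 : 0 <= th by rewrite divr_ge0 // ltW.
have th1 : th <= 1 by rewrite ler_pdivrMr // mul1r.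
have thlev : th * lev = t by rewrite divfK // gt_eqF.
pose u (v : bool * bool) : R := th * (v.1%:R - v.2%:R).
pose U s := u (sign_class tau (x s)).
have iFV (g : bool * bool -> R) :
    mu.-integrable D (EFin \o (fun s => g (sign_class tau (x s)))).
  by apply: (finite_valued_integrable mD muD g mx) => v; exact: measurable_sign_class.
have mFV (g : bool * bool -> R) : measurable_fun D (fun s => g (sign_class tau (x s))).
  by apply: (finite_valued_measurable g mx) => v; exact: measurable_sign_class.
have u1 v : `|u v| <= 1.
  rewrite normrM ger0_norm // -[leRHS]mulr1 ler_pM //.
  by case: v => [[] []]; rewrite /= ?subrr ?subr0 ?sub0r ?normrN ?normr1 ?normr0.
have UE s : D s -> `|U s| = th * \1_(level_set D x tau) s /\ tau * `|U s| <= x s * U s.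
  move=> Ds; have -> : \1_(level_set D x tau) s = ((tau < x s) || (x s < - tau))%:R :> R.
    rewrite indicE -(ltrNr tau) -ltr_normr; congr (nat_of_bool _)%:R.
    by apply/idP/idP => [/set_mem[]|h] //; apply/mem_set.
  rewrite /U /u /sign_class /=; have [h1|h1] := ltP tau (x s).
    have -> /= : (x s < - tau) = false by apply/negbTE; rewrite -leNgt; lra.
    by rewrite subr0 !mulr1 ger0_norm // ler_wpM2r // ltW.
  have [h2|h2] := ltP (x s) (- tau); last by rewrite subrr !mulr0 normr0 mulr0.
  rewrite /= sub0r mulrN1 normrN !mulr1 ger0_norm // mulrN -mulNr ler_wpM2r //.
  by rewrite lerNr ltW.
have iU : mu.-integrable D (EFin \o U) := iFV u.
have iaU : mu.-integrable D (EFin \o (fun s => `|U s|)) := iFV (fun v => `|u v|).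
have intU : \int[mu]_(s in D) `|U s| = t.
  transitivity (\int[mu]_(s in D) (th * \1_(level_set D x tau) s)).
    by apply: eq_Rintegral => s /set_mem Ds; have [] := UE s Ds.
  have levD : D `&` level_set D x tau = level_set D x tau by apply/setIidr => s [].
  rewrite RintegralZl //; last first.
    apply: (@bounded_integrable _ _ _ mu D mD muD D _ 1) => // s _.
    by rewrite indicE; case: (s \in _); rewrite ?normr1 ?normr0.
  by rewrite (@Rintegral_indic_setI _ _ _ mu D mD (level_set D x tau)) levD.
pose e := \int[mu]_(s in D) U s.
have et : `|e| <= t by rewrite -intU; exact: le_normr_Rintegral.
have eD (c : R) : \int[mu]_(s in D) c = c by rewrite Rintegral_cst // muD mulr1.
have ic (c : R) : mu.-integrable D (EFin \o (fun=> c : R)) := iFV (fun=> c).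
(* As [|u - e| <= 2], dividing by 4 gives the bound [1 / 2]. It also gives [a^2 <= (|U| + t) / 8],
   so the [L_1] norm [t] controls the variance. *)
pose a v := (u v - e) / 4.
have aE s : a (sign_class tau (x s)) = 4^-1 * (U s - e) by rewrite /a mulrC.
exists tau, a; split.
  move=> v; rewrite /a normrM (ger0_norm (_ : 0 <= 4^-1)) // ler_pdivrMr //.
  by rewrite (le_trans (ler_normB _ _)) //; have := u1 v; lra.
  under eq_Rintegral do rewrite aE.
  rewrite RintegralZl //; last exact: (iFV (fun v => u v - e)).
  by rewrite RintegralB // eD subrr mulr0.
  apply: (@le_trans _ _ (\int[mu]_(s in D) (8^-1 * (`|U s| + t)))).
    apply: le_Rintegral => //.
      exact: (iFV (fun v => a v ^+ 2)).
      exact: (iFV (fun v => 8^-1 * (`|u v| + t))).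
    move=> s Ds; rewrite aE; have := ler_normB (U s) e; have := u1 (sign_class tau (x s)).
    rewrite -/(U s) exprMn -[(U s - e) ^+ 2]real_normK ?num_real //.
    by have := normr_ge0 (U s - e); move: et; move: `|e| `|U s - e| `|U s| => v y z; nra.
  rewrite RintegralZl //; last exact: (iFV (fun v => `|u v| + t)).
  by rewrite RintegralD // eD intU; lra.
have ixU : mu.-integrable D (EFin \o (fun s => x s * U s)).
  by apply: (@bounded_mul_integrable _ _ 1) => // [|s]; [exact: (mFV u)|exact: u1].
have ixe : mu.-integrable D (EFin \o (fun s => x s * e)).
  by apply: (@bounded_mul_integrable _ _ `|e|).
(* Centring does not change the pairing because [x] has mean zero. *)
have -> : \int[mu]_(s in D) (x s * a (sign_class tau (x s))) =
    4^-1 * \int[mu]_(s in D) (x s * U s).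
  transitivity (\int[mu]_(s in D) (4^-1 * (x s * U s - x s * e))).
    by apply: eq_Rintegral => s _; rewrite aE; ring.
  rewrite RintegralZl //; last exact: (integrableB mD ixU ixe).
  by rewrite RintegralB // RintegralZr // x0 mul0r subr0.
have : tau * t <= \int[mu]_(s in D) (x s * U s).
  rewrite -intU -RintegralZl //; apply: le_Rintegral => //.
    exact: (iFV (fun v => tau * `|u v|)).
  by move=> s Ds; have [] := UE s Ds.
rewrite /tau; lra.
Qed.

End DualStep.

(** * The dual functions and the boundedness of the pairing with them *)

Section DualOperator.
Context d (T : measurableType d) (R : realType).
Variables (mu : {measure set T -> \bar R}) (D : set T).
Hypotheses (mD : measurable D) (muD : mu D = 1%E).
Variables (p q : R).
Hypotheses (p12 : 1 < p < 2) (q12 : 1 <= q <= 2).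

Let pc : R := 1 - p^-1.
(** The smaller of two decay rates: [1/p - 1/2] for [i <= j], and [pc / 2] for [i > j], where the
    other half of [pc] absorbs the factor [1 + i - j]. With [eta = pc / 2] that absorption has the
    constant [20 / eta], which is [K0]. *)
Let eps : R := Num.min (p^-1 - 1 / 2) (pc / 2).
Let rho : R := expR (- (eps * ln 2)).
Let K0 : R := 40 / pc.

Let ln2_gt0 : 0 < ln 2 :> R. Proof. by rewrite ln_gt0 // ltr1n. Qed.

Let p_gt0 : 0 < p. Proof. by case/andP: p12 => p1 _; exact: lt_trans p1. Qed.

Let pV_bounds : 1 / 2 < p^-1 < 1.
Proof.
case/andP: p12 => p1 p2; rewrite invf_lt1 ?p_gt0 // p1 andbT.
by rewrite mul1r ltf_pV2 ?posrE ?p_gt0.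
Qed.

Let pc_gt0 : 0 < pc. Proof. by rewrite subr_gt0; case/andP: pV_bounds. Qed.

Let eps_gt0 : 0 < eps.
Proof. by rewrite lt_min subr_gt0 divr_gt0 // andbT; case/andP: pV_bounds. Qed.

Let rho_bounds : 0 <= rho < 1.
Proof. by rewrite expR_ge0 expR_lt1 oppr_lt0 mulr_gt0. Qed.

Let K0_ge4 : 4 <= K0.
Proof.
rewrite ler_pdivlMr //; have : pc < 1 by rewrite /pc gtrBl invr_gt0.
by lra.
Qed.

Let rhoX n : rho ^+ n = expR (- (n%:R * eps * ln 2)).
Proof. by rewrite -expRM_natl; congr expR; ring. Qed.

Section Level.
Variables (N : nat) (I : finType) (f : 'I_N -> T -> R).
Variables (kap : 'I_N -> R -> I) (a : 'I_N -> I -> R) (c : 'I_N -> R) (j : nat).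
Hypotheses (mf : forall k, measurable_fun D (f k)) (indf : mutually_independent mu D f).
Hypothesis mkap : forall k v, measurable (kap k @^-1` [set v]).
Hypothesis a_le : forall k v, `|a k v| <= 1 / 2.
Hypothesis a_mean : forall k, \int[mu]_(s in D) a k (kap k (f k s)) = 0.
Hypothesis a_var : forall k,
  \int[mu]_(s in D) (a k (kap k (f k s))) ^+ 2 <= 2^-1 ^+ j / 4.
Hypothesis c_le : \sum_k c k ^+ 2 <= 1.

(** With [nu = 2^-1 ^+ i] and [del = 2^-1 ^+ j], the logarithm is [L = (i - j) ln 2], and its sign
    selects the estimate for large or for small sets. Compared with the weights on the right, either
    one has decay at rate at least [eps] to spare. *)
Lemma integral_abs_weighted_sum_level_le (x : T -> R) i : measurable_fun D x ->
  (\int[mu]_(s in dyadic_level mu D x i) `|\sum_k c k * a k (kap k (f k s))|%:E <=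
   (K0 * rho ^+ ((i - j) + (j - i)) * (2^-1 ^+ i) `^ p^-1 * (2^-1 ^+ j) `^ pc)%:E)%E.
Proof.
move=> mx; pose F := dyadic_level mu D x i.
have mF : measurable F by exact: measurable_dyadic_level.
have FD : F `<=` D := @dyadic_level_sub _ _ _ mu D x i.
have Fnu : (mu F <= (2 * 2^-1 ^+ i)%:E)%E by exact: mu_dyadic_level_le.
have nu0 : 0 <= 2^-1 ^+ i :> R by exact: exprn_ge0.
have del01 : 0 <= (2^-1 ^+ j : R) <= 1.
  by rewrite exprn_ge0 //= exprn_ile1 // invf_le1 // ler1n.
pose L : R := (i%:R - j%:R) * ln 2.
have dE : 2^-1 ^+ j = 2^-1 ^+ i * expR L.
  by rewrite !half_expnE -expRD; congr expR; rewrite /L; ring.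
have K4 := K0_ge4; have K0E : 20 / (pc / 2) = K0 by rewrite /K0; field; rewrite gt_eqF.
clearbody K0.
have e1 : eps <= p^-1 - 1 / 2 by rewrite ge_min lexx.
have e2 : eps <= pc / 2 by rewrite ge_min lexx orbT.
have [ij|/ltnW ji] := leqP i j.
  have := integral_abs_weighted_sum_le_half mD muD mf indf mkap del01 a_le a_mean
    a_var c_le mF FD Fnu nu0 dE.
  move=> h; apply: le_trans h _; rewrite lee_fin (eqP (ij : (i - j)%N == 0%N)).
  rewrite add0n rhoX !half_powRE.
  rewrite half_expnE natrB // -!mulrA -!expRD; apply: ler_pM => //.
  rewrite ler_expR /L.
  have u0 : 0 <= (j%:R - i%:R) * ln 2 :> R by rewrite mulr_ge0 ?subr_ge0 ?ler_nat // ltW.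
  have e3 : 0 <= p^-1 - 1 / 2 - eps by lra.
  by have := mulr_ge0 u0 e3; rewrite /pc; lra.
have pc1 : 0 < pc / 2 <= 1.
  rewrite divr_gt0 //=; have : 0 < p^-1 by rewrite invr_gt0.
  by rewrite /pc; lra.
have L0 : 0 <= L by rewrite mulr_ge0 ?subr_ge0 ?ler_nat // ltW.
have := integral_abs_weighted_sum_le_small mD muD mf indf mkap del01 a_le a_mean
  a_var c_le mF FD Fnu nu0 dE L0 pc1.
move=> h; apply: le_trans h _; rewrite lee_fin (eqP (ji : (j - i)%N == 0%N)).
rewrite addn0 rhoX !half_powRE.
rewrite K0E.
rewrite half_expnE natrB // -!mulrA -!expRD; apply: ler_pM => //.
  by rewrite (le_trans _ K4).
rewrite ler_expR.
have e3 : 0 <= pc - pc / 2 - eps by lra.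
by have := mulr_ge0 L0 e3; rewrite /L /pc; lra.
Qed.
End Level.

Let q_gt0 : 0 < q. Proof. by case/andP: q12 => q1 _; exact: lt_le_trans q1. Qed.

Lemma dyadic_partial_sum_le (x : T -> R) n : (dyadic_sum mu D p q x < +oo)%E ->
  \sum_(i < n) dyadic_coef mu D p x i `^ q <= fine (dyadic_sum mu D p q x).
Proof.
move=> xoo; have xfin : dyadic_sum mu D p q x \is a fin_num.
  by rewrite ge0_fin_numE ?dyadic_sum_ge0.
rewrite -lee_fin fineK //; apply: partial_sum_le_nneseries => i; exact: powR_ge0.
Qed.

(** [L_{p,q}] lies in [L_1] because [p > 1]: the dyadic bound of the integral is the sum of the
    coefficients against the geometric weights [2^(-i pc)], and [y <= y^q + 1] reduces it to the
    dyadic sum plus a geometric series. *)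
Lemma dyadic_sum_integrable (x : T -> R) : measurable_fun D x ->
  (dyadic_sum mu D p q x < +oo)%E -> mu.-integrable D (EFin \o x).
Proof.
move=> mx xoo; apply/integrableP; split; first exact/measurable_EFinP.
have a0 i : 0 <= dyadic_coef mu D p x i by exact: dyadic_coef_ge0.
have h0 i : 0 <= dyadic_rearr mu D x i by exact: dyadic_rearr_ge0.
have half1 i : 0 <= (2^-1 ^+ i : R) <= 1.
  by rewrite exprn_ge0 //= exprn_ile1 // invf_le1 // ler1n.
have half_split i : 2^-1 ^+ i = (2^-1 ^+ i) `^ p^-1 * (2^-1 ^+ i) `^ pc :> R.
  by rewrite !half_powRE half_expnE -expRD; congr expR; rewrite /pc; ring.
have le_rho i : (2^-1 ^+ i) `^ pc <= rho ^+ i.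
  rewrite rhoX half_powRE ler_expR lerN2 ler_wpM2r ?(ltW ln2_gt0) // ler_wpM2l //.
  by rewrite (@le_trans _ _ (pc / 2)) ?ge_min ?lexx ?orbT //; move: pc_gt0; lra.
have le_one i : (2^-1 ^+ i) `^ pc <= 1.
  by rewrite (le_trans (le_rho i)) // exprn_ile1 //; case/andP: rho_bounds => // _ /ltW.
apply: (@le_lt_trans _ _
    (\sum_(i <oo) (2 * (dyadic_coef mu D p x i `^ q + rho ^+ i))%:E)%E).
  have := @integral_abs_mul_dyadic_le _ _ _ mu D mD muD x (fun=> 1) mx.
  move=> /(_ (@measurable_cst _ _ _ _ _ _) (fun=> ler01)) h.
  apply: le_trans (le_trans _ h) _.
    by under [leRHS]eq_integral do rewrite mulr1.
  apply: lee_nneseries => i.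
    by move=> _ _; rewrite mule_ge0 ?lee_fin // integral_ge0.
  move=> _; rewrite integral_cst; last exact: measurable_dyadic_level.
  rewrite mul1e; apply: le_trans (lee_wpmul2l _ (mu_dyadic_level_le mD muD i mx)) _.
    by rewrite lee_fin.
  rewrite -EFinM lee_fin mulrCA ler_wpM2l // [X in _ * X <= _]half_split mulrA.
  rewrite -/(dyadic_coef mu D p x i); have := a0 i.
  move: (dyadic_coef _ _ _ _ _) => y y0.
  have yq : y <= y `^ q + 1.
    have [y1|/ltW y1] := leP y 1; first by rewrite (le_trans y1) // lerDr powR_ge0.
    by rewrite (@le_trans _ _ (y `^ q)) ?lerDl // le1r_powR //; case/andP: q12.
  have := le_rho i; have := le_one i; have := powR_ge0 (2^-1 ^+ i) pc; have := powR_ge0 y q.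
  move: yq; move: (_ `^ pc) (y `^ q) (rho ^+ i) => z w v yw w0 z0 z1 zv.
  have := mulr_ge0 z0 (_ : 0 <= w + 1 - y).
  have := mulr_ge0 w0 (_ : 0 <= 1 - z); rewrite !subr_ge0 => /(_ z1) + /(_ yw); lra.
apply: (@le_lt_trans _ _ (2 * (fine (dyadic_sum mu D p q x) + 2 / (1 - rho)))%:E);
  last exact: ltry.
apply: nneseries_le_partial => [i|n].
  by rewrite mulr_ge0 // addr_ge0 ?powR_ge0 // exprn_ge0 //; case/andP: rho_bounds.
rewrite -mulr_sumr ler_wpM2l // big_split /= lerD ?dyadic_partial_sum_le //.
rewrite (eq_bigr (fun i : 'I_n => rho ^+ ((i - 0) + (0 - i)))).
  exact: geometric_dist_sum_le.
by move=> i _; rewrite subn0 sub0n addn0.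
Qed.

Section DualPairing.
Variables (N : nat) (I : finType) (f : 'I_N -> T -> R) (M : nat).
Variables (kap : 'I_N -> nat -> R -> I) (a : 'I_N -> nat -> I -> R).
Variables (b : 'I_N -> nat -> R).
Hypotheses (mf : forall k, measurable_fun D (f k)) (indf : mutually_independent mu D f).
Hypothesis mkap : forall k j v, measurable (kap k j @^-1` [set v]).
Hypothesis a_le : forall k j v, `|a k j v| <= 1 / 2.
Hypothesis a_mean : forall k j, \int[mu]_(s in D) a k j (kap k j (f k s)) = 0.
Hypothesis a_var : forall k j,
  \int[mu]_(s in D) (a k j (kap k j (f k s))) ^+ 2 <= 2^-1 ^+ j / 4.
Hypothesis b_ge0 : forall k j, 0 <= b k j.
Hypothesis b_le : forall k, \sum_(j < M) b k j `^ q <= 1.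

(* The power of [2^-1 ^+ j] is [2^(j/p')], with [1/p + 1/p' = 1], and the powers
   of [b k] are the coefficients of the norming functional of [b k] in [l_q]. *)
Definition dual_function k s : R :=
  \sum_(j < M) b k j `^ (q - 1) * (2^-1 ^+ j) `^ (- (1 - p^-1)) *
    a k j (kap k j (f k s)).

Lemma measurable_dual_function k : measurable_fun D (dual_function k).
Proof.
apply: measurable_sum => j; apply: measurable_funM => //.
exact: (finite_valued_measurable (a k j) (mf k) (mkap k j)).
Qed.

Lemma dual_function_bounded k : exists B, forall s, `|dual_function k s| <= B.
Proof.
exists (\sum_(j < M) b k j `^ (q - 1) * (2^-1 ^+ j) `^ (- (1 - p^-1))) => s.
apply: le_trans (ler_norm_sum _ _ _) _; apply: ler_sum => j _.
have w0 : 0 <= b k j `^ (q - 1) * (2^-1 ^+ j) `^ (- (1 - p^-1)).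
  by rewrite mulr_ge0 ?powR_ge0.
rewrite normrM (ger0_norm w0) ler_piMr //.
by have := a_le k j (kap k j (f k s)); lra.
Qed.

Lemma dual_pairing_le (c : 'I_N -> R) (x : T -> R) :
  \sum_k c k ^+ 2 <= 1 -> measurable_fun D x ->
  (dyadic_sum mu D p q x <= 1)%E ->
  \sum_k c k * \int[mu]_(s in D) (x s * dual_function k s) <= 4 * K0 / (1 - rho).
Proof.
move=> c1 mx x1.
have xoo : (dyadic_sum mu D p q x < +oo)%E by apply: le_lt_trans x1 _; exact: ltry.
have ix := dyadic_sum_integrable mx xoo.
pose W j : R := (2^-1 ^+ j) `^ (- pc).
pose C j : R := Num.sqrt (\sum_k (c k * b k j `^ (q - 1)) ^+ 2).
(* The coefficients at level [j] are normalized in [l_2], as the level estimate requires. If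
   [C j = 0], division by zero makes [c' j] vanish, consistently with [cC]. *)
pose c' j k : R := c k * b k j `^ (q - 1) / C j.
pose S j s : R := \sum_k c' j k * a k j (kap k j (f k s)).
have W0 j : 0 <= W j by exact: powR_ge0.
have C0 j : 0 <= C j by exact: sqrtr_ge0.
have cC j k : c k * b k j `^ (q - 1) = C j * c' j k.
  have [Cj0|Cj0] := eqVneq (C j) 0; last by rewrite /c' mulrCA divff // mulr1.
  rewrite Cj0 mul0r; apply/eqP; rewrite -sqrf_eq0.
  have s0 : 0 <= \sum_k (c k * b k j `^ (q - 1)) ^+ 2.
    by apply: sumr_ge0 => i _; exact: sqr_ge0.
  have /eqP := Cj0; rewrite sqrtr_eq0 => s1.
  have /psumr_eq0P -> // : \sum_k (c k * b k j `^ (q - 1)) ^+ 2 = 0.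
    by apply/eqP; rewrite eq_le s1.
  by move=> i _; exact: sqr_ge0.
have c'1 j : \sum_k c' j k ^+ 2 <= 1.
  have [Cj0|Cj0] := eqVneq (C j) 0.
    by rewrite big1 // => k _; rewrite /c' Cj0 invr0 mulr0 expr0n.
  under eq_bigr do rewrite exprMn.
  rewrite -mulr_suml -[X in X * _]sqr_sqrtr; last by apply: sumr_ge0 => i _; exact: sqr_ge0.
  by rewrite -/(C j) exprVn divff // sqrf_eq0.
have mS j : measurable_fun D (S j).
  apply: measurable_sum => k; apply: measurable_funM => //.
  exact: (finite_valued_measurable (a k j) (mf k) (mkap k j)).
have YE s : \sum_k c k * dual_function k s = \sum_(j < M) W j * C j * S j s.
  rewrite /dual_function; under eq_bigr do rewrite mulr_sumr.
  rewrite exchange_big /=; apply: eq_bigr => j _; rewrite /S mulr_sumr.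
  apply: eq_bigr => k _; rewrite -/(W j) -[W j * C j * _]mulrA [C j * _]mulrA -cC.
  by rewrite -/pc /W; ring.
pose h i := dyadic_rearr mu D x i.
pose A i := dyadic_coef mu D p x i `^ q.
pose E j := \sum_k c k ^+ 2 * b k j `^ q.
have h0 i : 0 <= h i by exact: dyadic_rearr_ge0.
have A0 i : 0 <= A i by exact: powR_ge0.
have E0 j : 0 <= E j by apply: sumr_ge0 => k _; rewrite mulr_ge0 ?sqr_ge0 ?powR_ge0.
have r0 n : 0 <= rho ^+ n by rewrite exprn_ge0 //; case/andP: rho_bounds.
have K00 : 0 <= K0 by apply: le_trans K0_ge4.
have level j i : ((W j * C j)%:E * ((h i)%:E *
      \int[mu]_(s in dyadic_level mu D x i) `|S j s|%:E) <=
    (K0 * rho ^+ ((i - j) + (j - i)) * (A i + E j))%:E)%E.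
  have := @integral_abs_weighted_sum_level_le N I f (kap ^~ j) (a ^~ j) (c' j) j
    mf indf (fun k => mkap k j) (fun k => a_le k j) (fun k => a_mean k j)
    (fun k => a_var k j) (c'1 j) x i mx.
  move=> /(lee_wpmul2l (_ : (0 <= ((W j * C j) * h i)%:E)%E)).
  rewrite lee_fin => /(_ (mulr_ge0 (mulr_ge0 (W0 j) (C0 j)) (h0 i))).
  rewrite [in X in (X <= _)%E]EFinM -muleA => hle; apply: le_trans hle _.
  rewrite -EFinM lee_fin.
  have WE : W j * (2^-1 ^+ j) `^ pc = 1.
    by rewrite /W powRN mulVf // gt_eqF // powR_gt0 // exprn_gt0.
  have -> : W j * C j * h i * (K0 * rho ^+ (i - j + (j - i)) * (2^-1 ^+ i) `^ p^-1 *
      (2^-1 ^+ j) `^ pc) = K0 * rho ^+ (i - j + (j - i)) *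
      ((W j * (2^-1 ^+ j) `^ pc) * (dyadic_coef mu D p x i * C j)).
    by rewrite /dyadic_coef -/(h i); ring.
  rewrite WE mul1r; apply: ler_wpM2l; first exact: mulr_ge0 K00 (r0 _).
  by apply: mul_sqrt_sum_le => //; exact: dyadic_coef_ge0.
have pairing_j j : ((W j * C j)%:E * \int[mu]_(s in D) (`|x s| * `|S j s|)%:E <=
    \sum_(i <oo) (K0 * rho ^+ ((i - j) + (j - i)) * (A i + E j))%:E)%E.
  have mnS : measurable_fun D (fun s => `|S j s|) by exact: measurableT_comp.
  have WC0 : (0 <= (W j * C j)%:E)%E by rewrite lee_fin mulr_ge0.
  have := integral_abs_mul_dyadic_le mD muD mx mnS (fun s => normr_ge0 (S j s)).
  move=> /(lee_wpmul2l WC0) hle; apply: le_trans hle _.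
  have F0 i : (0 <= (dyadic_rearr mu D x i)%:E *
      \int[mu]_(s in dyadic_level mu D x i) `|S j s|%:E)%E.
    by rewrite mule_ge0 ?lee_fin // integral_ge0.
  rewrite -nneseriesZl; last by move=> i _; exact: F0.
  apply: lee_nneseries => [i _ _|i _]; last exact: level.
  by rewrite mule_ge0.
have pairE : \sum_k c k * \int[mu]_(s in D) (x s * dual_function k s) =
    \int[mu]_(s in D) (x s * \sum_(j < M) W j * C j * S j s).
  have ixg k : mu.-integrable D (EFin \o (fun s => x s * dual_function k s)).
    have [B hB] := dual_function_bounded k.
    by apply: (bounded_mul_integrable mD ix _ hB); exact: measurable_dual_function.
  under eq_bigr do rewrite -RintegralZl //.
  rewrite -Rintegral_sum //; last first.
    by move=> k; exact: (integrableZl mD (c k) (ixg k)).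
  apply: eq_Rintegral => s _; rewrite -YE mulr_sumr; apply: eq_bigr => k _; ring.
rewrite pairE; pose Y s := \sum_(j < M) W j * C j * S j s.
have mY : measurable_fun D Y.
  by apply: measurable_sum => j; apply: measurable_funM.
have mxS j : measurable_fun D (fun s => (`|x s| * `|S j s|)%:E).
  by apply/measurable_EFinP; apply: measurable_funM; exact: measurableT_comp.
have bnd : (\int[mu]_(s in D) `|x s * Y s|%:E <= (4 * K0 / (1 - rho))%:E)%E.
  apply: (@le_trans _ _ (\int[mu]_(s in D)
      (\sum_(j < M) (W j * C j)%:E * (`|x s| * `|S j s|)%:E))%E).
    apply: ge0_le_integral => //.
      by apply/measurable_EFinP; apply: measurableT_comp => //; exact: measurable_funM.
      by apply: emeasurable_sum => j; apply: emeasurable_funM.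
    move=> s _; under eq_bigr do rewrite -EFinM.
    rewrite sumEFin lee_fin normrM.
    under eq_bigr do rewrite mulrCA.
    rewrite -mulr_sumr ler_wpM2l //; apply: le_trans (ler_norm_sum _ _ _) _.
    by apply: ler_sum => j _; rewrite normrM ger0_norm // mulr_ge0.
  rewrite ge0_integral_sum //; last 2 first.
    by move=> j; apply: emeasurable_funM.
    by move=> j s _; rewrite -EFinM lee_fin !mulr_ge0.
  under eq_bigr do rewrite ge0_integralZl_EFin ?mulr_ge0 //.
  apply: (@le_trans _ _ (\sum_(j < M) \sum_(i <oo)
      (K0 * rho ^+ ((i - j) + (j - i)) * (A i + E j))%:E)%E).
    by apply: lee_sum => j _; exact: pairing_j.
  have term0 i j : 0 <= K0 * rho ^+ ((i - j) + (j - i)) * (A i + E j).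
    by apply: mulr_ge0; [exact: mulr_ge0 K00 (r0 _)|exact: addr_ge0].
  rewrite -nneseries_sum; last by move=> j i _; rewrite lee_fin term0.
  under eq_eseriesr do rewrite sumEFin.
  apply: nneseries_le_partial => [i|n]; first by apply: sumr_ge0 => j _; exact: term0.
  have sumA : \sum_(i < n) A i <= 1.
    apply: le_trans (dyadic_partial_sum_le n xoo) _; rewrite -lee_fin fineK //.
    by rewrite ge0_fin_numE ?dyadic_sum_ge0.
  have sumE : \sum_(j < M) E j <= 1.
    rewrite /E exchange_big /=; apply: le_trans c1; apply: ler_sum => k _.
    by rewrite -mulr_sumr ler_piMr ?sqr_ge0 ?b_le.
  pose g : R := 2 / (1 - rho).
  have g0 : 0 <= g by rewrite divr_ge0 // subr_ge0; case/andP: rho_bounds => _ /ltW.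
  (* Schur test: row and column sums of the matrix are at most [g], and [A] and [E] each have total
     mass at most 1, hence the factor [1 + 1]. *)
  apply: (@le_trans _ _ (K0 * (g * \sum_(i < n) A i + g * \sum_(j < M) E j))); last first.
    rewrite -mulrDr (_ : 4 * K0 / (1 - rho) = K0 * (g * (1 + 1))); last by rewrite /g; ring.
    by apply: (ler_wpM2l K00); apply: (ler_wpM2l g0); exact: lerD.
  have -> : \sum_(i < n) \sum_(j < M) K0 * rho ^+ ((i - j) + (j - i)) * (A i + E j) =
      K0 * (\sum_(i < n) A i * (\sum_(j < M) rho ^+ ((j - i) + (i - j))) +
            \sum_(j < M) E j * (\sum_(i < n) rho ^+ ((i - j) + (j - i)))).
    under [X in _ + X]eq_bigr do rewrite mulr_sumr.
    rewrite [X in _ + X]exchange_big -big_split /= mulr_sumr; apply: eq_bigr => i _.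
    rewrite mulr_sumr -big_split /= mulr_sumr; apply: eq_bigr => j _.
    by rewrite (addnC (j - i)%N); ring.
  apply: (ler_wpM2l K00); apply: lerD; rewrite mulr_sumr; apply: ler_sum => i _.
    by rewrite mulrC ler_wpM2r // geometric_dist_sum_le.
  by rewrite mulrC ler_wpM2r // geometric_dist_sum_le.
have ixY : mu.-integrable D (EFin \o (fun s => x s * Y s)).
  apply/integrableP; split; last by apply: le_lt_trans bnd _; exact: ltry.
  by apply/measurable_EFinP; exact: measurable_funM.
apply: le_trans (ler_norm _) _; rewrite -lee_fin EFin_normr_Rintegral //.
by apply: le_trans bnd; apply: le_abse_integral => //; exact: (measurable_int mu ixY).
Qed.

End DualPairing.

Section MutualOrthogonality.
Variables (N : nat) (f : 'I_N -> T -> R).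
Hypotheses (mf : forall k, measurable_fun D (f k)) (indf : mutually_independent mu D f).

Lemma mutually_independent_pair k l (A B : set R) : k != l ->
  measurable A -> measurable B ->
  mu (D `&` [set s | B (f k s)] `&` f l @^-1` A) =
    (mu (D `&` [set s | B (f k s)]) * mu (D `&` f l @^-1` A))%E.
Proof.
move=> kl mA mB.
pose C (i : 'I_N) : set R := if i == k then B else A.
have mC i : measurable (C i) by rewrite /C; case: ifP.
have := indf [set k; l]%SET mC.
rewrite big_setU1 ?inE // big_set1 /C eqxx (eq_sym l) (negbTE kl).
move=> <-; congr (mu _); rewrite -setIA; congr (_ `&` _).
apply/seteqP; split => s /=.
  by move=> [Bs As] i; rewrite !inE => /orP[/eqP->|/eqP->]; rewrite ?eqxx // eq_sym (negbTE kl).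
move=> h; split.
  by have := h k; rewrite eqxx; apply; rewrite !inE eqxx.
by have := h l; rewrite eq_sym (negbTE kl); apply; rewrite !inE eqxx orbT.
Qed.

Lemma Rintegral_finite_valued_orthogonal (I : finType) (kap : R -> I) (a : I -> R) k l :
  k != l -> (forall v, measurable (kap @^-1` [set v])) ->
  mu.-integrable D (EFin \o f l) -> (\int[mu]_(s in D) (f l s)%:E = 0)%E ->
  \int[mu]_(s in D) (f l s * a (kap (f k s))) = 0.
Proof.
move=> kl mkap il l0.
pose E v := [set s | (kap @^-1` [set v]) (f k s)].
have mE v : measurable (D `&` E v) by exact: mf.
have iE v : mu.-integrable D (EFin \o (fun s => f l s * \1_(E v) s)).
  apply: (bounded_mul_integrable mD il (M := 1)).
    apply: (@eq_measurable_fun _ _ _ _ D (\1_(D `&` E v) : T -> R)).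
      by move=> s sD; rewrite !indicE in_setI sD.
    exact: measurable_indic.
  by move=> s; rewrite indicE; case: (s \in E v); rewrite ?normr1 ?normr0.
transitivity (\int[mu]_(s in D) \sum_v a v * (f l s * \1_(E v) s)).
  apply: eq_Rintegral => s _; rewrite finite_valued_indicE mulr_sumr.
  by apply: eq_bigr => v _; rewrite mulrCA.
rewrite Rintegral_sum //; last by move=> v; exact: (integrableZl mD (a v) (iE v)).
rewrite big1 // => v _; rewrite RintegralZl //.
rewrite (@Rintegral_independent_mean_zero _ _ _ mu D mD (E v)) ?mulr0 //.
  by apply: (mu_sub_fin_num mD muD (mE v)) => s [].
by move=> A mA; exact: mutually_independent_pair.
Qed.
End MutualOrthogonality.

Let C0 : R := 4 * K0 / (1 - rho).

Let C0_gt0 : 0 < C0.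
Proof.
have K00 : 0 < K0 by apply: lt_le_trans K0_ge4.
rewrite /C0; apply: divr_gt0; first exact: mulr_gt0.
by rewrite subr_gt0; case/andP: rho_bounds.
Qed.

(** Duality in [l_2]: the bilinear bound is tested on the normalized vector of pairings and on [x]
    rescaled to the unit ball. *)
Lemma dual_sum_sqr_le N (g : 'I_N -> T -> R) (x : T -> R) :
  (forall (c : 'I_N -> R) (y : T -> R), \sum_k c k ^+ 2 <= 1 -> measurable_fun D y ->
     (dyadic_sum mu D p q y <= 1)%E ->
     \sum_k c k * \int[mu]_(s in D) (y s * g k s) <= C0) ->
  (forall k, measurable_fun D (g k)) -> (forall k, exists B : R, forall s, `|g k s| <= B) ->
  measurable_fun D x -> (dyadic_sum mu D p q x < +oo)%E ->
  \sum_k (\int[mu]_(s in D) (x s * g k s)) ^+ 2 <=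
    (C0 * fine (dyadic_sum mu D p q x) `^ q^-1) ^+ 2.
Proof.
move=> hC mg bg mx xoo; have C00 := C0_gt0; clearbody C0.
have ix := dyadic_sum_integrable mx xoo.
pose y k := \int[mu]_(s in D) (x s * g k s).
pose Y := \sum_k y k ^+ 2; pose n := Num.sqrt Y.
have Y0 : 0 <= Y by apply: sumr_ge0 => k _; exact: sqr_ge0.
have n2 : n ^+ 2 = Y by exact: sqr_sqrtr.
rewrite -/Y -n2; have n0 : 0 <= n by exact: sqrtr_ge0.
have S0 := fine_ge0 (dyadic_sum_ge0 mu D p q x).
have SE : dyadic_sum mu D p q x = (fine (dyadic_sum mu D p q x))%:E.
  by rewrite fineK // ge0_fin_numE ?dyadic_sum_ge0.
set S := fine _ in S0 SE *.
rewrite ler_sqr ?nnegrE ?mulr_ge0 ?powR_ge0 ?(ltW C00) //.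
have [->|n_neq0] := eqVneq n 0; first by rewrite mulr_ge0 ?powR_ge0 ?(ltW C00).
have {n_neq0} n_gt0 : 0 < n by rewrite lt_neqAle eq_sym n_neq0.
apply/ler_addgt0Pr => e e0.
(* The slack [e / C0] keeps [lam] positive even if [S = 0]; it contributes exactly [e] to the final
   bound. *)
pose lam := S `^ q^-1 + e / C0.
have lam0 : 0 < lam by rewrite ltr_wpDl ?powR_ge0 // divr_gt0.
suff : n <= C0 * lam by rewrite mulrDr mulrCA divff ?mulr1 // gt_eqF.
have Slam : S <= lam `^ q.
  have SqE : (S `^ q^-1) `^ q = S by rewrite -powRrM mulVf ?gt_eqF // powRr1.
  rewrite -[leLHS]SqE.
  apply: ge0_ler_powR; rewrite ?nnegrE ?powR_ge0 ?(ltW q_gt0) ?(ltW lam0) //.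
  by rewrite lerDl divr_ge0 // ltW.
have my : measurable_fun D (fun s => lam^-1 * x s) by exact: measurable_funM.
have y1 : (dyadic_sum mu D p q (fun s => lam^-1 * x s)%R <= 1)%E.
  apply: le_trans (dyadic_sumZ_le mD muD _ _ _ mx) _; first by case/andP: q12.
  rewrite SE -EFinM lee_fin ger0_norm ?invr_ge0 ?(ltW lam0) //.
  by rewrite powR_invl ?(ltW lam0) // mulrC ler_pdivrMr ?mul1r // powR_gt0.
have c1 : \sum_k (y k / n) ^+ 2 <= 1.
  under eq_bigr do rewrite exprMn.
  by rewrite -mulr_suml -/Y -n2 -exprMn divff ?expr1n // gt_eqF.
have := hC _ _ c1 my y1.
have ixg k : mu.-integrable D (EFin \o (fun s => x s * g k s)).
  by have [B hB] := bg k; exact: (bounded_mul_integrable mD ix (mg k) hB).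
have -> : \sum_k y k / n * \int[mu]_(s in D) (lam^-1 * x s * g k s) = n / lam.
  transitivity (\sum_k y k ^+ 2 / n / lam).
    apply: eq_bigr => k _; under eq_Rintegral do rewrite -mulrA.
    by rewrite RintegralZl // -/(y k); ring.
  by rewrite -!mulr_suml -/Y -n2 expr2 mulfK // gt_eqF.
by rewrite ler_pdivrMr.
Qed.

Theorem exists_biorthogonal_functions : exists K : R, 0 < K /\
  forall N (f : 'I_N -> T -> R) (s0 : R), 0 < s0 ->
    (forall k, measurable_fun D (f k)) -> mutually_independent mu D f ->
    (forall k, (\int[mu]_(s in D) (f k s)%:E = 0)%E) ->
    (forall k, (dyadic_sum mu D p q (f k) < +oo)%E) ->
    (forall k, s0 <= fine (dyadic_sum mu D p q (f k)) `^ q^-1) ->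
  exists g : 'I_N -> T -> R,
    [/\ forall k, measurable_fun D (g k), forall k, exists B : R, forall s, `|g k s| <= B,
        forall k l, \int[mu]_(s in D) (f l s * g k s) = (k == l)%:R &
        forall x, measurable_fun D x -> (dyadic_sum mu D p q x < +oo)%E ->
          \sum_k (\int[mu]_(s in D) (x s * g k s)) ^+ 2 <=
            (K / s0 * fine (dyadic_sum mu D p q x) `^ q^-1) ^+ 2].
Proof.
(* The factor 16 is 8 from [exists_dual_step] times 2 from truncating to [M] levels. *)
exists (16 * C0); split; first by rewrite mulr_gt0.
move=> N f s0 s00 mf indf f0 foo fs0.
have iff k : mu.-integrable D (EFin \o f k) := dyadic_sum_integrable (mf k) (foo k).
pose al k j := dyadic_coef mu D p (f k) j.
have al0 k j : 0 <= al k j by exact: dyadic_coef_ge0.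
pose S k := fine (dyadic_sum mu D p q (f k)).
have SE k : (\sum_(j <oo) (al k j `^ q)%:E = (S k)%:E)%E.
  by rewrite fineK // ge0_fin_numE ?dyadic_sum_ge0.
have S_ge0 k : 0 <= S k by apply/fine_ge0/dyadic_sum_ge0.
have S_gt0 k : 0 < S k.
  rewrite lt_neqAle S_ge0 andbT; apply/eqP => Sk0; have := fs0 k.
  by rewrite -/(S k) -Sk0 powR0 ?invr_eq0 ?gt_eqF // leNgt s00.
(* A single cut-off for all [k] makes every dual function a finite sum, hence bounded. Keeping half
   of the sum costs [2^(1/q) <= 2] in the norm. *)
have [M hM] : exists M, forall k, S k / 2 <= \sum_(j < M) al k j `^ q.
  have /choice[m hm] k :=
    exists_partial_sum_half (fun j => powR_ge0 (al k j) q) (SE k) (S_gt0 k).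
  exists (\max_k m k)%N => k; apply: hm; exact: leq_bigmax.
pose P k := \sum_(j < M) al k j `^ q.
have P0 k : 0 < P k by apply: lt_le_trans (hM k); rewrite divr_gt0.
pose sig k := P k `^ q^-1.
have sig0 k : 0 < sig k by exact: powR_gt0.
have sigq k : sig k `^ q = P k by rewrite -powRrM mulVf ?gt_eqF // powRr1 // ltW.
pose b k j := al k j / sig k.
have b0 k j : 0 <= b k j by rewrite divr_ge0 // ltW.
have bq k : \sum_(j < M) b k j `^ q = 1.
  under eq_bigr do rewrite powRM ?invr_ge0 ?(ltW (sig0 k)) // powR_invl ?(ltW (sig0 k)) //.
  by rewrite -mulr_suml -/(P k) sigq divff // gt_eqF.
have half01 j : 0 < (2^-1 ^+ j : R) <= 1.
  by rewrite exprn_gt0 //= exprn_ile1 // invf_le1 // ler1n.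
have f0' k : \int[mu]_(s in D) f k s = 0 by rewrite /Rintegral f0.
have step k j := exists_dual_step mD muD (mf k) (iff k) (f0' k) (half01 j).
have /choice[tau] k : exists t : nat -> R, forall j, exists (a : bool * bool -> R),
    [/\ forall v, `|a v| <= 1 / 2,
        \int[mu]_(s in D) a (sign_class (t j) (f k s)) = 0,
        \int[mu]_(s in D) (a (sign_class (t j) (f k s))) ^+ 2 <= 2^-1 ^+ j / 4 &
        rearr mu D (f k) (2^-1 ^+ j) * 2^-1 ^+ j / 8 <=
          \int[mu]_(s in D) (f k s * a (sign_class (t j) (f k s)))].
  by have /choice[t ht] := step k; exists t.
move=> htau.
have /choice[a ha] k : exists a : nat -> bool * bool -> R, forall j,
    [/\ forall v, `|a j v| <= 1 / 2,
        \int[mu]_(s in D) a j (sign_class (tau k j) (f k s)) = 0,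
        \int[mu]_(s in D) (a j (sign_class (tau k j) (f k s))) ^+ 2 <= 2^-1 ^+ j / 4 &
        rearr mu D (f k) (2^-1 ^+ j) * 2^-1 ^+ j / 8 <=
          \int[mu]_(s in D) (f k s * a j (sign_class (tau k j) (f k s)))].
  by have /choice[a ha] := htau k; exists a.
have a_le k j v : `|a k j v| <= 1 / 2 by have [] := ha k j.
have mkap k j v : measurable (sign_class (tau k j) @^-1` [set v]).
  exact: measurable_sign_class.
pose G k s := dual_function f M (fun k j => sign_class (tau k j)) a b k s.
have mG k : measurable_fun D (G k) := measurable_dual_function M a b mf mkap k.
have bG k : exists B : R, forall s, `|G k s| <= B :=
  dual_function_bounded f M (fun k j => sign_class (tau k j)) b a_le k.
pose W j : R := (2^-1 ^+ j) `^ (- (1 - p^-1)).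
have GE k l : \int[mu]_(s in D) (f l s * G k s) =
    \sum_(j < M) b k j `^ (q - 1) * W j *
      \int[mu]_(s in D) (f l s * a k j (sign_class (tau k j) (f k s))).
  have it j : mu.-integrable D
      (EFin \o (fun s => f l s * a k j (sign_class (tau k j) (f k s)))).
    apply: (bounded_mul_integrable mD (iff l) _ (M := 1 / 2)) => // .
    exact: (finite_valued_measurable (a k j) (mf k) (mkap k j)).
  transitivity (\int[mu]_(s in D) \sum_(j < M) b k j `^ (q - 1) * W j *
      (f l s * a k j (sign_class (tau k j) (f k s)))).
    by apply: eq_Rintegral => s _; rewrite mulr_sumr; apply: eq_bigr => j _; rewrite mulrCA.
  rewrite Rintegral_sum //; last by move=> j; exact: (integrableZl mD _ (it j)).
  by apply: eq_bigr => j _; rewrite RintegralZl.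
pose t k := \int[mu]_(s in D) (f k s * G k s).
have t_ge k : sig k / 8 <= t k.
  rewrite /t GE (_ : sig k / 8 = \sum_(j < M) b k j `^ (q - 1) * W j *
      (rearr mu D (f k) (2^-1 ^+ j) * 2^-1 ^+ j / 8)).
    apply: ler_sum => j _; apply: ler_wpM2l; first by rewrite mulr_ge0 ?powR_ge0.
    by have [] := ha k j.
  (* The norming functional of [l_q]: since [al = sig * b], the sum of [b^(q-1) * al] is [sig] times
     the sum of [b^q], which is 1. *)
  have -> : sig k / 8 = \sum_(j < M) sig k * b k j `^ q / 8.
    by rewrite -mulr_suml -mulr_sumr bq mulr1.
  apply: eq_bigr => j _.
  have WE : W j * 2^-1 ^+ j = (2^-1 ^+ j) `^ p^-1.
    by rewrite /W !half_powRE half_expnE -expRD; congr expR; ring.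
  rewrite -(mulr_powRB1 (b0 k j) q_gt0) {1}/b.
  have -> : b k j `^ (q - 1) * W j * (rearr mu D (f k) (2^-1 ^+ j) * 2^-1 ^+ j / 8) =
      b k j `^ (q - 1) * (rearr mu D (f k) (2^-1 ^+ j) * (W j * 2^-1 ^+ j)) / 8 by ring.
  rewrite WE -/(dyadic_rearr mu D (f k) j) -/(dyadic_coef mu D p (f k) j) -/(al k j).
  by field; rewrite gt_eqF.
have sig_ge k : s0 / 2 <= sig k.
  apply: (@le_trans _ _ ((S k / 2) `^ q^-1)); last first.
    by apply: ge0_ler_powR; rewrite ?nnegrE ?invr_ge0 ?divr_ge0 ?(ltW q_gt0) ?(ltW (P0 k)).
  rewrite powRM // ler_pM ?(ltW s00) //; first exact: fs0.
  have half1 : 0 < (2^-1 : R) <= 1 by rewrite invr_gt0 ltr0n /= invf_le1 // ler1n.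
  by apply: (ger1_powR half1); rewrite invf_le1 //; case/andP: q12.
have t_ge_s0 k : s0 / 16 <= t k by have := sig_ge k; have := t_ge k; lra.
have t_gt0 k : 0 < t k by apply: lt_le_trans (t_ge_s0 k); rewrite divr_gt0.
have ixG k x : measurable_fun D x -> (dyadic_sum mu D p q x < +oo)%E ->
    mu.-integrable D (EFin \o (fun s => x s * G k s)).
  move=> mx xoo; have [B hB] := bG k.
  exact: (bounded_mul_integrable mD (dyadic_sum_integrable mx xoo) (mG k) hB).
have gE k x : measurable_fun D x -> (dyadic_sum mu D p q x < +oo)%E ->
    \int[mu]_(s in D) (x s * (G k s / t k)) = (\int[mu]_(s in D) (x s * G k s)) / t k.
  move=> mx xoo; under eq_Rintegral do rewrite mulrA.
  by rewrite RintegralZr //; exact: ixG.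
exists (fun k s => G k s / t k); split.
  by move=> k; apply: measurable_funM.
  move=> k; have [B hB] := bG k; exists (B / t k) => s.
  have tV0 : 0 <= (t k)^-1 by rewrite invr_ge0 ltW.
  by rewrite normrM (ger0_norm tV0) ler_wpM2r.
  move=> k l; rewrite gE //; have [->|kl] := eqVneq k l;
    first by rewrite -/(t l) divff // gt_eqF.
  rewrite GE big1 ?mul0r // => j _.
  by rewrite (Rintegral_finite_valued_orthogonal mf indf (a k j) kl (mkap k j)) ?mulr0.
move=> x mx xoo.
have main : \sum_k (\int[mu]_(s in D) (x s * G k s)) ^+ 2 <=
    (C0 * fine (dyadic_sum mu D p q x) `^ q^-1) ^+ 2.
  apply: dual_sum_sqr_le => // c y c1 my y1; apply: dual_pairing_le => //.
    by move=> k j; have [] := ha k j.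
    by move=> k j; have [] := ha k j.
  by move=> k; rewrite bq.
have -> : (16 * C0 / s0 * fine (dyadic_sum mu D p q x) `^ q^-1) ^+ 2 =
    (16 / s0) ^+ 2 * (C0 * fine (dyadic_sum mu D p q x) `^ q^-1) ^+ 2.
  by rewrite -exprMn; congr (_ ^+ 2); ring.
apply: le_trans (ler_wpM2l (sqr_ge0 _) main); rewrite mulr_sumr; apply: ler_sum => k _.
rewrite gE // exprMn mulrC ler_wpM2r ?sqr_ge0 //.
rewrite ler_sqr ?nnegrE ?invr_ge0 ?divr_ge0 ?(ltW (t_gt0 k)) ?(ltW s00) //.
by rewrite -[leRHS]invrK lef_pV2 ?posrE ?invr_gt0 ?divr_gt0 // invf_div.
Qed.

End DualOperator.

(** * The averaged width *)

Lemma Rintegral_sub_lincomb d (T : measurableType d) (R : realType)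
    (mu : {measure set T -> \bar R}) (D : set T) (n : nat) (x g : T -> R)
    (a : 'I_n -> R) (v : 'I_n -> T -> R) :
  measurable D -> mu.-integrable D (EFin \o (fun s => x s * g s)) ->
  (forall i, mu.-integrable D (EFin \o (fun s => v i s * g s))) ->
  \int[mu]_(s in D) ((x s - \sum_(i < n) a i * v i s) * g s) =
    \int[mu]_(s in D) (x s * g s) - \sum_(i < n) a i * \int[mu]_(s in D) (v i s * g s).
Proof.
move=> mD ix iv.
have iav i : mu.-integrable D (EFin \o (fun s => a i * (v i s * g s))).
  exact: (integrableZl mD (a i) (iv i)).
have isum : mu.-integrable D (EFin \o (fun s => \sum_(i < n) a i * (v i s * g s))).
  have := @integrable_sum _ _ _ mu D mD _ (index_enum 'I_n) xpredT _ (fun i _ => iav i).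
  by apply: eq_integrable => // s _; rewrite /= sumEFin.
transitivity (\int[mu]_(s in D) (x s * g s - \sum_(i < n) a i * (v i s * g s))).
  apply: eq_Rintegral => s _; rewrite mulrBl mulr_suml; congr (_ - _).
  by apply: eq_bigr => i _; rewrite mulrA.
rewrite (RintegralB mD ix isum) (Rintegral_sum mD _ iav).
by congr (_ - _); apply: eq_bigr => i _; rewrite RintegralZl.
Qed.

Section LorentzClosure.
Context {R : realType}.
Variables (p q : R).
Hypotheses (p0 : 0 < p) (q1 : 1 <= q).

Lemma lorentz_spaceD (x y : lebR R -> R) :
  lorentz_space p q x -> lorentz_space p q y -> lorentz_space p q (fun s => x s + y s).
Proof.
move=> /(lorentz_space_dyadicE p0 q1)[mx xoo] /(lorentz_space_dyadicE p0 q1)[my yoo].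
apply/(lorentz_space_dyadicE p0 q1); split; first exact: measurable_funD.
exact: (dyadic_sumD_lty (@measurable_I01 R) mu_I01 q1 mx my xoo yoo).
Qed.

Lemma lorentz_spaceZ (r : R) (x : lebR R -> R) :
  lorentz_space p q x -> lorentz_space p q (fun s => r * x s).
Proof.
move=> /(lorentz_space_dyadicE p0 q1)[mx xoo].
apply/(lorentz_space_dyadicE p0 q1); split; first exact: measurable_funM.
exact: (dyadic_sumZ_lty (@measurable_I01 R) mu_I01 q1 r mx xoo).
Qed.

Lemma lorentz_space_sub_lincomb n (x : lebR R -> R) (a : 'I_n -> R)
    (v : 'I_n -> lebR R -> R) :
  lorentz_space p q x -> (forall i, lorentz_space p q (v i)) ->
  lorentz_space p q (fun s => x s - \sum_(i < n) a i * v i s).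
Proof.
move=> xL vL; elim: (index_enum _) => [|i r IHr].
  rewrite [X in lorentz_space _ _ X](_ : _ = x) //.
  by apply/funext => s; rewrite big_nil subr0.
rewrite [X in lorentz_space _ _ X](_ : _ =
  fun s => (x s - \sum_(j <- r) a j * v j s) + (- a i) * v i s).
  exact: lorentz_spaceD IHr (lorentz_spaceZ _ (vL i)).
by apply/funext => s; rewrite big_cons; ring.
Qed.

End LorentzClosure.

Lemma lorentz_norm_equivalent (R : realType) (p q : R) (nrm : (lebR R -> R) -> R) :
  is_lorentz_norm p q nrm -> exists A B : R, [/\ 0 < A, 0 < B &
    forall x, lorentz_space p q x ->
      A * fine (lorentz_functional p q x) <= nrm x <= B * fine (lorentz_functional p q x)].
Proof.
case=> [nrmE|[_ []]] //; exists 1, 1; split => // x xL.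
by rewrite nrmE // !mul1r lexx.
Qed.

(** The [T l] are the coordinates of a map to Euclidean space that takes [f k] to the basis vector
    [e_k] and satisfies [c |T x| <= nrm x]. Distances of [f k] from the span of the [v i] are thus
    at least [c] times those of [e_k] from the row space of the matrix [T l (v i)]. *)
Lemma avg_width2_ge (R : realType) (X : set (lebR R -> R)) (nrm : (lebR R -> R) -> R)
    (n N : nat) (f : 'I_N -> lebR R -> R) (T : 'I_N -> (lebR R -> R) -> R) (c : R) :
  (n < N)%N -> 0 <= c -> (forall k, X (f k)) ->
  (forall x (v : 'I_n -> lebR R -> R) (a : 'I_n -> R), X x -> (forall i, X (v i)) ->
     X (fun s => x s - \sum_(i < n) a i * v i s) /\
     forall l, T l (fun s => x s - \sum_(i < n) a i * v i s) =
       T l x - \sum_(i < n) a i * T l (v i)) ->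
  (forall k l, T l (f k) = (l == k)%:R) ->
  (forall x, X x -> 0 <= nrm x /\ c ^+ 2 * \sum_l T l x ^+ 2 <= nrm x ^+ 2) ->
  c * Num.sqrt (1 - n%:R / N%:R) <= avg_width2 X nrm n f.
Proof.
move=> nN c0 fX XT Tf Tle; have N0 : (0 < N)%N := leq_ltn_trans (leq0n n) nN.
apply: lb_le_inf.
  (* A witness that the infimum is taken over a nonempty set. *)
  pose v (i : 'I_n) := f (Ordinal N0).
  exists (Num.sqrt (N%:R^-1 * \sum_(k < N) dist_to nrm (f k) (lin_span v) ^+ 2)).
  by exists (lin_span v); [exists v => // i; exact: fX|].
move=> _ [_ [v vX ->] <-].
have [d [dN dle]] := sum_dist_rowspace (\matrix_(i < n, l < N) T l (v i)).
have dist_ge k : c ^+ 2 * d k <= dist_to nrm (f k) (lin_span v) ^+ 2.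
  (* The sign of [d k] is not recorded by [sum_dist_rowspace]; for a negative value the bound is
     trivial. *)
  have [d0|d0] := leP 0 (d k); last first.
    rewrite (@le_trans _ _ 0) ?sqr_ge0 // mulr_ge0_le0 ?sqr_ge0 ?ltW //.
  have : c * Num.sqrt (d k) <= dist_to nrm (f k) (lin_span v).
    apply: lb_le_inf.
      exists (nrm (fun s => f k s - \sum_(i < n) 0 * v i s)).
      by exists (fun s => \sum_(i < n) 0 * v i s); [exists (fun=> 0)|].
    move=> _ [_ [a _ <-] <-].
    have [yX Ty] := XT (f k) v a (fX k) vX.
    have [y0 yle] := Tle _ yX.
    rewrite -ler_sqr ?nnegrE ?mulr_ge0 ?sqrtr_ge0 // exprMn sqr_sqrtr //.
    apply: le_trans yle; rewrite ler_wpM2l ?sqr_ge0 //.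
    pose w := \row_l (T l (f k) - \sum_(i < n) a i * T l (v i)).
    have -> : \sum_l T l (fun s => f k s - \sum_(i < n) a i * v i s) ^+ 2 =
        \sum_l w 0 l ^+ 2.
      by apply: eq_bigr => l _; rewrite Ty mxE.
    apply: dle; apply/submxP; exists (\row_i a i).
    apply/rowP => l; rewrite !mxE /= Tf opprB addrCA subrr addr0 //.
    by apply: eq_bigr => i _; rewrite !mxE.
  move=> h; rewrite -[d k]sqr_sqrtr // -exprMn ler_sqr ?nnegrE //.
    by rewrite mulr_ge0 ?sqrtr_ge0.
  by apply: le_trans h; rewrite mulr_ge0 ?sqrtr_ge0.
have NR0 : 0 < N%:R :> R by rewrite ltr0n.
have -> : c * Num.sqrt (1 - n%:R / N%:R) = Num.sqrt (c ^+ 2 * (1 - n%:R / N%:R)).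
  by rewrite sqrtrM ?sqr_ge0 // sqrtr_sqr ger0_norm.
apply: ler_wsqrtr.
apply: (@le_trans _ _ (N%:R^-1 * \sum_(k < N) c ^+ 2 * d k)); last first.
  by rewrite ler_wpM2l ?invr_ge0 ?ler0n //; apply: ler_sum.
have -> : N%:R^-1 * \sum_(k < N) c ^+ 2 * d k = c ^+ 2 * ((\sum_k d k) / N%:R).
  by rewrite -mulr_sumr; ring.
rewrite ler_wpM2l ?sqr_ge0 // ler_pdivlMr //.
by rewrite mulrBl mul1r divfK ?gt_eqF.
Qed.

Theorem corollary3p9 (R : realType) (p q : R)
    (hp : 1 < p < 2) (hq : 1 <= q <= 2)
    (nrm : (lebR R -> R) -> R) (hnrm : is_lorentz_norm p q nrm) :
  exists c : R, 0 < c /\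
    forall (N : nat) (f : 'I_N -> lebR R -> R),
      (forall k, lorentz_space p q (f k)) ->
      (forall k, mean_zero (f k)) ->
      independent_functions f ->
      (forall k, 1 <= nrm (f k)) ->
      forall n : nat, (n < N)%N ->
        c * Num.sqrt (1 - n%:R / N%:R)
          <= avg_width2 (lorentz_space p q) nrm n f.
Proof.
pose m := @completed_lebesgue_measure R.
have p0 : 0 < p by case/andP: hp => p1 _; exact: lt_trans p1.
have q1 : 1 <= q by case/andP: hq.
have [A [B [A0 B0 nrmAB]]] := lorentz_norm_equivalent hnrm.
have [c1 [C1 [c10 C10 lfE]]] := lorentz_functional_dyadic p0 q1.
have [K [K0 bio]] := exists_biorthogonal_functions (@measurable_I01 R) mu_I01 hp hq.
pose F (x : lebR R -> R) :=
  fine (dyadic_sum (@completed_lebesgue_measure R) (@I01 R) p q x) `^ q^-1.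
have F0 x : 0 <= F x by exact: powR_ge0.
have nrmF x : lorentz_space p q x -> A * c1 * F x <= nrm x <= B * C1 * F x.
  move=> xL; have /andP[n1 n2] := nrmAB x xL; have /andP[f1 f2] := lfE x xL.
  rewrite -!mulrA (le_trans _ n1) ?(ler_wpM2l (ltW A0)) //=.
  by rewrite (le_trans n2) // (ler_wpM2l (ltW B0)).
(* The lower bound on the dyadic norms that [1 <= nrm (f k)] yields. *)
pose s0 := (B * C1)^-1; have s00 : 0 < s0 by rewrite invr_gt0 mulr_gt0.
(* [K / s0] bounds the pairing operator in terms of the dyadic norm [F], and [A * c1] passes from
   [F] to [nrm]. *)
pose c := A * c1 * s0 / K; have c0 : 0 < c by rewrite divr_gt0 ?mulr_gt0.
exists c; split => // N f fL f0 indf f1 n nN.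
have fD k : measurable_fun (@I01 R) (f k) /\
    (dyadic_sum (@completed_lebesgue_measure R) (@I01 R) p q (f k) < +oo)%E.
  exact/(lorentz_space_dyadicE p0 q1).
have fs0 k : s0 <= F (f k).
  have /andP[_ h] := nrmF _ (fL k).
  by rewrite /s0 -[leLHS]mul1r ler_pdivrMr ?mulr_gt0 // mulrC (le_trans (f1 k)).
have [g [mg bg fg gle]] := bio N f s0 s00 (fun k => (fD k).1) indf f0
  (fun k => (fD k).2) fs0.
have int_mul x k : lorentz_space p q x ->
    m.-integrable (@I01 R) (EFin \o (fun s => x s * g k s)).
  move=> /(lorentz_space_dyadicE p0 q1)[mx xoo]; have [C hC] := bg k.
  have ix := dyadic_sum_integrable (@measurable_I01 R) mu_I01 hp hq mx xoo.
  exact: (bounded_mul_integrable (@measurable_I01 R) ix (mg k) hC).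
pose T l (x : lebR R -> R) := \int[m]_(s in @I01 R) (x s * g l s).
apply: (@avg_width2_ge R _ nrm n N f T c nN (ltW c0) fL).
  move=> x v a xL vL; split; first exact: lorentz_space_sub_lincomb.
  by move=> l; exact: (@Rintegral_sub_lincomb _ _ R m (@I01 R) n x (g l) a v
    (@measurable_I01 R) (int_mul x l xL) (fun i => int_mul (v i) l (vL i))).
  by move=> k l; exact: fg.
move=> x xL; have /andP[nx _] := nrmF x xL.
have nx0 : 0 <= A * c1 * F x by rewrite !mulr_ge0 // ltW.
split; first exact: le_trans nx.
have [mx xoo] := (lorentz_space_dyadicE p0 q1 x).1 xL.
apply: le_trans (ler_wpM2l (sqr_ge0 c) (gle x mx xoo)) _.
have -> : c ^+ 2 * (K / s0 * F x) ^+ 2 = (A * c1 * F x) ^+ 2.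
  by rewrite -exprMn; congr (_ ^+ 2); rewrite /c; field; rewrite !gt_eqF.
by rewrite ler_sqr ?nnegrE // (le_trans nx0).
Qed.
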